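(* Let $\mathcal X_1$ be a finite or countable set and let $d\in\mathbb N$. Fix $\sigma>0$, $\epsilon>0$ and $x=(x_1,x_2)\in\mathcal X_1\times\mathbb R^D$. Assume the randomized smoothing corruption distribution factorizes as $$p(z\mid x)=p_1(z_1\mid x_1)\,p_2(z_2\mid x_2),\qquad p_2(\cdot\mid x_2)=\mathcal N(x_2,\sigma^2 I_D),$$ with $p_1(\cdot\mid x_1)$ a probability mass function on $\mathcal X_1$ (and likewise at the adversarial input below). Fix an adversarial input $x_{\mathrm{adv}}=(x_{1,\mathrm{adv}},x_{2,\mathrm{adv}})$ with $D_1(x_1,x_{1,\mathrm{adv}})\le d$ and $\|x_{2,\mathrm{adv}}-x_2\|_2\le\epsilon$. Write $\Delta:=x_{2,\mathrm{adv}}-x_2$ and $r:=\|\Delta\|_2$. Assume absolute continuity in the discrete channel: for all $z_1$, $p_1(z_1\mid x_1)=0$ implies $p_1(z_1\mid x_{1,\mathrm{adv}})=0$; and define, for $p_1(z_1\mid x_1)>0$, $$\gamma_1(z_1):=\frac{p_1(z_1\mid x_{1,\mathrm{adv}})}{p_1(z_1\mid x_1)}.$$ Let $f:\mathcal X_1\times\mathbb R^D\to\{0,1\}$ be any measurable base classifier and let the smoothed value at the clean input be $$p_A:=\mathbb E_{z\sim p(\cdot\mid x)}[f(z)]\in(0,1).$$ For a fixed discrete adversarial input $x_{1,\mathrm{adv}}$ and a fixed continuous radius $r>0$, define the adversarial value $$(\ast)\qquad V(x_{1,\mathrm{adv}};r):=\inf_{0\le h\le 1}\ \mathbb E_{z\sim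 p(\cdot\mid x_{\mathrm{adv}})}[h(z)]\quad\text{s.t.}\quad \mathbb E_{z\sim p(\cdot\mid x)}[h(z)]=p_A .$$ Then the unique optimal solution of $(\ast)$ is given by a likelihood-ratio threshold test $$h^\star(z_1,z_2)=\mathbf 1\{\gamma(z_1,z_2;r)\le t^\star(r)\},\qquad \gamma(z_1,z_2;r):=\gamma_1(z_1)\,\gamma_2(z_2;r),$$ where $\gamma_2$ is the Gaussian likelihood ratio $$\gamma_2(z_2;r):=\frac{\phi_\sigma(z_2-x_{2,\mathrm{adv}})}{\phi_\sigma(z_2-x_2)}=\exp\!\left(\frac{1}{\sigma^2}\Delta^\top\Big(z_2-\frac{x_2+x_{2,\mathrm{adv}}}{2}\Big)\right),$$ and $t^\star(r)>0$ is the unique solution of $$F(t;r)=p_A,\qquad F(t;r):=\sum_{z_1}p_1(z_1\mid x_1)\,\Phi\!\left(\frac{\frac{r^2}{2}+\sigma^2(\log t-\log\gamma_1(z_1))}{\sigma r}\right).$$ The corresponding optimal adversarial value admits the closed form $$V(x_{1,\mathrm{adv}};r)=\sum_{z_1}p_1(z_1\mid x_{1,\mathrm{adv}})\,\Phi\!\left(\frac{\frac{r^2}{2}+\sigma^2(\log t^\star(r)-\log\gamma_1(z_1))}{\sigma r}-\frac{r}{\sigma}\right).$$ Moreover, for every fixed $x_{1,\mathrm{adv}}$, the map $r\mapsto V(x_{1,\mathrm{adv}};r)$ is nonincreasing on $(0,\infty)$. Hence, under the constraint $\|x_{2,\mathrm{adv}}-x_2\|_2\le\epsilon$, the worst case is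 attained at $r=\epsilon$. Finally, the hybrid worst-case smoothed value under budgets $(d,\epsilon)$ is defined as $$p_{\mathrm{adv}}(d,\epsilon):=\inf_{D_1(x_1,x_{1,\mathrm{adv}})\le d}V(x_{1,\mathrm{adv}};\epsilon).$$
   Context: $D_1$ is a task-specific perturbation metric on the discrete space $\mathcal X_1$; $d$ is the discrete budget and $\epsilon$ the continuous $\ell_2$ budget. For any input $y=(y_1,y_2)\in\mathcal X_1\times\mathbb R^D$, $p(\cdot\mid y)$ denotes the product law $p_1(\cdot\mid y_1)\otimes\mathcal N(y_2,\sigma^2 I_D)$; in particular this is used at $x$ and at $x_{\mathrm{adv}}$. In $(\ast)$, $h$ ranges over measurable functions $\mathcal X_1\times\mathbb R^D\to[0,1]$, and $x_{\mathrm{adv}}=(x_{1,\mathrm{adv}},x_{2,\mathrm{adv}})$ with $\|x_{2,\mathrm{adv}}-x_2\|_2=r$. $\phi_\sigma$ is the density of $\mathcal N(0,\sigma^2 I_D)$ and $\Phi$ is the standard normal cumulative distribution function. The sums over $z_1$ range over $z_1\in\mathcal X_1$ with $p_1(z_1\mid x_1)>0$; when $\gamma_1(z_1)=0$, one reads $\log 0=-\infty$ and $\Phi(+\infty)=1$. The functions $\gamma_1$, $F$ and the threshold $t^\star(r)$ depend on $x_{1,\mathrm{adv}}$.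
   Formalization: The threshold test, t* and the closed form are claimed only when the p_1(·|x_1)-probability of γ_1=0 is below p_A (otherwise no t*>0 solves F(t;r)=p_A), and the optimal solution is unique up to p(·|x)-null sets. *)

(* Defs.v *)
From HB Require Import structures.
From mathcomp Require Import all_boot all_order all_algebra.
From mathcomp Require Import all_classical all_reals all_analysis.
Set Implicit Arguments.
Unset Strict Implicit.
Unset Printing Implicit Defensive.
Import Order.TTheory GRing.Theory Num.Theory.
Import numFieldNormedType.Exports.
Local Open Scope classical_set_scope.
Local Open Scope ring_scope.

(* Vectors of R^D are D-tuples because tuples carry the product sigma-algebra
   of the Borel sigma-algebras; row vectors have no measurable structure, and
   their norm is the sup norm. *)
Notation vec R D := (D.-tuple (measurableTypeR R)).

Definition vsub (R : realType) (D : nat) (u v : vec R D) : vec R D :=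
  [tuple (tnth u i - tnth v i : R) | i < D].

Definition midpoint (R : realType) (D : nat) (u v : vec R D) : vec R D :=
  [tuple ((tnth u i + tnth v i) / 2 : R) | i < D].

Definition dot (R : realType) (D : nat) (u v : vec R D) : R :=
  \sum_(i < D) ((tnth u i : R) * (tnth v i : R)).

Definition l2norm (R : realType) (D : nat) (u : vec R D) : R :=
  Num.sqrt (dot u u).

Definition is_metric (R : realType) (T : Type) (dist : T -> T -> R) : Prop :=
  [/\ forall a b, 0 <= dist a b,
      forall a b, dist a b = 0 <-> a = b,
      forall a b, dist a b = dist b a &
      forall a b c, dist a c <= dist a b + dist b c].

Definition tuple_cons (R : realType) (D : nat)
    (z : measurableTypeR R * vec R D) : vec R D.+1 :=
  [tuple of z.1 :: z.2].

Lemma measurable_tuple_cons (R : realType) (D : nat) :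
  measurable_fun setT (@tuple_cons R D).
Proof. exact: measurable_cons. Qed.

HB.instance Definition _ (R : realType) (D : nat) :=
  @isMeasurableFun.Build _ _ _ _ (@tuple_cons R D)
    (@measurable_tuple_cons R D).

(* N(m, s^2 I_D), as the joint law of D independent N(m_i, s^2). *)
Fixpoint gaussian (R : realType) (s : R) (D : nat) :
    vec R D -> probability (vec R D) R :=
  match D with
  | 0 => fun m => dirac m
  | D'.+1 => fun m =>
      distribution (normal_prob (thead m) s \x gaussian s (behead_tuple m))%E
                   (@tuple_cons R D')
  end.

(* Density of N(0, s^2 I_D): the product of its one-dimensional densities. *)
Definition gaussian_pdf (R : realType) (s : R) (D : nat) (v : vec R D) : R :=
  \prod_(i < D) normal_pdf 0 s (tnth v i).

(* Standard normal cdf, extended so that Phi -oo = 0 and Phi +oo = 1. *)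
Definition Phi (R : realType) (u : \bar R) : R :=
  fine (normal_prob 0 1 [set w : measurableTypeR R | ((w : R)%:E <= u)%E]).

(* On a countable space all of whose subsets are measurable, a probability
   measure is the same thing as its probability mass function. *)
Definition mass (R : realType) (d1 : measure_display) (X1 : measurableType d1)
    (p : probability X1 R) (z : X1) : R :=
  fine (p [set z]).

Section HybridSmoothing.
Context (R : realType) (d1 : measure_display) (X1 : measurableType d1).
Context (D : nat) (p1 : X1 -> probability X1 R) (s : R).

Definition law (y : X1 * vec R D) : probability (X1 * vec R D)%type R :=
  (p1 y.1 \x gaussian s y.2)%E.

Definition smoothed (y : X1 * vec R D) (h : X1 * vec R D -> R) : \bar R :=
  ('E_(law y)[h])%E.

Context (x : X1 * vec R D) (pA : \bar R).
Implicit Types (h : X1 * vec R D -> R) (xadv : X1 * vec R D) (a : X1).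
Implicit Types (r t : R).

Definition feasible h : Prop :=
  [/\ measurable_fun setT h, forall z, 0 <= h z <= 1 & smoothed x h = pA].

Definition adv_value xadv : \bar R :=
  ereal_inf [set smoothed xadv h | h in feasible].

Definition optimal xadv h : Prop :=
  feasible h /\ smoothed xadv h = adv_value xadv.

(* Changing h on a null set changes neither the constraint nor the objective,
   so uniqueness is up to null sets of the clean law (which, under absolute
   continuity, are also null for the adversarial law). *)
Definition unique_optimal xadv h : Prop :=
  optimal xadv h /\
  forall h', optimal xadv h' -> {ae law x, forall z, h' z = h z}.

(* V(a; r) is to be the value at any adversarial input whose continuous part
   lies at distance r from that of x; the infimum over the sphere of radius r
   makes this a function of r without choosing a point of the sphere. *)
Definition V a r : \bar R :=
  ereal_inf [set adv_value (a, x2adv) |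
             x2adv in [set x2adv | l2norm (vsub x2adv x.2) = r]].

(* Only meaningful where mass (p1 x.1) z1 > 0 (division by 0 gives 0). *)
Definition gamma1 a (z1 : X1) : R := mass (p1 a) z1 / mass (p1 x.1) z1.

Definition gamma2 (x2adv z2 : vec R D) : R :=
  gaussian_pdf s (vsub z2 x2adv) / gaussian_pdf s (vsub z2 x.2).

Definition gamma xadv (z : X1 * vec R D) : R :=
  gamma1 xadv.1 z.1 * gamma2 xadv.2 z.2.

(* lne 0 = -oo, so for t > 0 this is +oo where gamma1 vanishes. *)
Definition threshold_arg a t r (z1 : X1) : \bar R :=
  (((r ^+ 2 / 2)%:E + (s ^+ 2)%:E * (lne t%:E - lne (gamma1 a z1)%:E))
     * ((s * r)^-1)%:E)%E.

Definition F a t r : \bar R :=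
  (\esum_(z1 in [set z1 | (0 < mass (p1 x.1) z1)%R])
     (mass (p1 x.1) z1 * Phi (threshold_arg a t r z1))%:E)%E.

Definition closed_form a t r : \bar R :=
  (\esum_(z1 in [set z1 | (0 < mass (p1 x.1) z1)%R])
     (mass (p1 a) z1 * Phi (threshold_arg a t r z1 - (r / s)%:E)%E)%:E)%E.

Definition p_adv (D1 : X1 -> X1 -> R) (d : nat) (eps : R) : \bar R :=
  ereal_inf [set V a eps | a in [set a | D1 x.1 a <= d%:R]].

End HybridSmoothing.

(* Main.v *)
Require Import Defs.
From HB Require Import structures.
From mathcomp Require Import all_boot all_order all_algebra.
From mathcomp Require Import all_classical all_reals all_analysis.
From mathcomp Require Import measurable_realfun ring lra.
Set Implicit Arguments.
Unset Strict Implicit.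
Unset Printing Implicit Defensive.
Import Order.TTheory GRing.Theory Num.Theory.
Import numFieldNormedType.Exports.
Local Open Scope classical_set_scope.
Local Open Scope ring_scope.

(** Under N(m, s^2 I_D) the functional z |-> <w, z> is normal with mean <w, m>
    and standard deviation s |w|: this follows by induction on D from the
    stability of one-dimensional normal laws.  Each slice at z1 of the event
    {gamma <= t} is a half-space orthogonal to Delta (or everything when gamma1
    vanishes), so Tonelli turns the clean and adversarial probabilities of this
    event into F and the closed form.  The adversarial law has density gamma
    with respect to the clean one, hence the threshold test is optimal by
    Neyman-Pearson, and uniquely so because gamma has no atom at t > 0.

    For monotonicity no derivative of the closed form is needed: the test that
    is optimal at radius r stays feasible when the adversarial mean is pushed
    further out along Delta, and its adversarial value can only decrease.  When
    pA <= p1(gamma1 = 0), a test supported on {gamma1 = 0} has adversarial value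
    0 at every radius. *)

(** * One-dimensional normal laws *)

(** The Radon-Nikodym derivative with respect to Lebesgue measure and [normal_pdf] have the same
    integral over every measurable set, hence agree almost everywhere. *)
Lemma integral_normal_prob (R : realType) (m s : R) (f : R -> \bar R) :
  measurable_fun [set: R] f -> (forall u, 0 <= f u)%E ->
  (\int[normal_prob m s]_u f u =
   \int[lebesgue_measure]_u (f u * (normal_pdf m s u)%:E))%E.
Proof.
move=> mf f0.
have dom := @normal_prob_dominates R m s.
rewrite -(Radon_Nikodym_SigmaFinite.change_of_variables dom)//.
have mpdf := @measurable_normal_pdf R m s.
apply: ae_eq_integral => //.
- apply: emeasurable_funM => //.
  exact: (measurable_int _ (Radon_Nikodym_SigmaFinite.f_integrable dom)).
- by apply: emeasurable_funM => //; exact/measurable_EFinP.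
apply: ae_eqe_mul2l; apply: integral_ae_eq => //.
- exact: Radon_Nikodym_SigmaFinite.f_integrable.
- exact/measurable_EFinP.
- by move=> A _ mA; rewrite -Radon_Nikodym_SigmaFinite.f_integral.
Qed.

Lemma preimage_affine_itv (R : realType) (m b x y : R) : b != 0 ->
  lebesgue_measure ((fun w : R => m + b * w) @^-1` `]x, y]) =
  ((`|b|^-1)%:E * lebesgue_measure `]x, y])%E.
Proof.
(* The first branch is [b < 0], despite the name [b_gt0]: the map reverses the order there, so the
   preimage is half-open on the other side. *)
move=> b0; have [b_gt0|b_lt0|/eqP] := ltgtP b 0; last by rewrite (negbTE b0).
- have -> : (fun w : R => m + b * w) @^-1` `]x, y] =
    `[(y - m) / b, (x - m) / b[%classic.
    apply/seteqP; split=> w /=; rewrite !in_itv/= ler_ndivrMr// ltr_ndivlMr//;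
    by move=> /andP[h1 h2]; apply/andP; split; lra.
  rewrite !lebesgue_measure_itv/= !lte_fin ltr_nM2r ?invr_lt0// ltrD2r.
  case: ifP => _; last by rewrite mule0.
  rewrite -!EFinD -EFinM; congr EFin.
  by rewrite ltr0_norm//; field.
- have -> : (fun w : R => m + b * w) @^-1` `]x, y] =
    `](x - m) / b, (y - m) / b]%classic.
    apply/seteqP; split=> w /=; rewrite !in_itv/= ler_pdivlMr// ltr_pdivrMr//;
    by move=> /andP[h1 h2]; apply/andP; split; lra.
  rewrite !lebesgue_measure_itv/= !lte_fin ltr_pM2r ?invr_gt0// ltrD2r.
  case: ifP => _; last by rewrite mule0.
  rewrite -!EFinD -EFinM; congr EFin.
  by rewrite gtr0_norm//; field.
Qed.

Lemma measurable_affine (R : realType) (m b : R) :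
  measurable_fun [set: measurableTypeR R]
    (fun w : measurableTypeR R => (m + b * w)%R : measurableTypeR R).
Proof. by apply: measurable_funD => //; exact: measurable_funM. Qed.

(** The right-hand side is a measure in [A] that agrees with Lebesgue measure on half-open
    intervals, and such a measure is unique. *)
Lemma lebesgue_measure_affine (R : realType) (m b : R) (A : set R) :
  b != 0 -> measurable A ->
  lebesgue_measure A =
  (`|b|%:E * lebesgue_measure ((fun w : R => m + b * w)%R @^-1` A))%E.
Proof.
move=> b0 mA.
pose nu : {measure set (measurableTypeR R) -> \bar R} :=
  measure_function_pushforward__canonical__measure_function_Measure
    lebesgue_measure (measurable_affine m b).
pose nu' := mscale (NngNum (normr_ge0 b)) nu.
rewrite -[RHS]/(nu' A); apply: lebesgue_measure_unique => // _ [[x y] _ <-].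
transitivity (`|b|%:E * ((`|b|^-1)%:E * lebesgue_measure `]x, y]))%E.
  by rewrite muleA -EFinM divff ?normr_eq0// mul1e.
by congr (_ * _)%E; exact/esym/preimage_affine_itv.
Qed.

Lemma ge0_integral_affine (R : realType) (m b : R) (f : R -> \bar R) :
  b != 0 -> measurable_fun [set: R] f -> (forall u, 0 <= f u)%E ->
  (\int[lebesgue_measure]_u f u =
   `|b|%:E * \int[lebesgue_measure]_w f (m + b * w)%R)%E.
Proof.
move=> b0 mf f0.
pose nu : {measure set (measurableTypeR R) -> \bar R} :=
  measure_function_pushforward__canonical__measure_function_Measure
    lebesgue_measure (measurable_affine m b).
pose nu' := mscale (NngNum (normr_ge0 b)) nu.
transitivity (\int[nu']_u f u)%E.
  apply: eq_measure_integral => A mA _.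
  exact: lebesgue_measure_affine.
rewrite ge0_integral_mscale//=; congr (_ * _)%E.
by rewrite /nu/= (ge0_integral_pushforward (measurable_affine m b)).
Qed.

(** Change of variables: the Jacobian [|b|] is absorbed by the normalizing constant. The sign of [b]
    is free because the density depends on [b] only through its square. *)
Lemma normal_prob_affine (R : realType) (m b : R) (A : set R) :
  b != 0 -> measurable A ->
  normal_prob 0 1 ((fun w : R => m + b * w)%R @^-1` A) = normal_prob m b A.
Proof.
move=> b0 mA; rewrite /normal_prob.
rewrite [RHS]integral_mkcond [LHS]integral_mkcond.
rewrite [RHS](@ge0_integral_affine _ m b)//; last 2 first.
- apply/(measurable_restrictT _ _).1 => //.
  by apply: measurable_funTS; apply/measurable_EFinP; exact: measurable_normal_pdf.
- by move=> u; apply: erestrict_ge0 => v _; rewrite lee_fin normal_pdf_ge0.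
rewrite -ge0_integralZl//; last 2 first.
- apply: (@measurableT_comp _ _ _ _ _ _ (_ \_ A) _ (fun w => (m + b * w)%R)).
    apply/(measurable_restrictT _ _).1 => //.
    by apply: measurable_funTS; apply/measurable_EFinP; exact: measurable_normal_pdf.
  exact: measurable_affine.
- by move=> u _; apply: erestrict_ge0 => v _; rewrite lee_fin normal_pdf_ge0.
apply: eq_integral => w _; rewrite !patchE.
have -> : (w \in (fun w : R => m + b * w)%R @^-1` A) = ((m + b * w)%R \in A).
  by apply/idP/idP; rewrite !inE.
case: ifP => _; last by rewrite mule0.
rewrite -EFinM; congr EFin; rewrite !normal_pdfE// /normal_peak /normal_fun.
rewrite /= mulrA; congr (_ * expR _); last by field.
rewrite expr1n mul1r -mulrnAr sqrtrM ?sqr_ge0// sqrtr_sqr invfM mulrA.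
by rewrite divff ?normr_eq0// mul1r.
Qed.

(** Completing the square. The left side is the joint density of U ~ N(0, 1) and Y given U ~ N(aU,
    b^2); the right side factors it as the marginal of Y times the conditional density of U given
    Y. *)
Lemma normal_pdf_convolution (R : realType) (a b u y : R) : b != 0 ->
  let c := Num.sqrt (a ^+ 2 + b ^+ 2) in
  normal_pdf (a * u) b y * normal_pdf 0 1 u =
  normal_pdf 0 c y * normal_pdf (a * y / c ^+ 2) (b / c) u.
Proof.
move=> b0 c.
have c2 : c ^+ 2 = a ^+ 2 + b ^+ 2 by rewrite sqr_sqrtr// addr_ge0// sqr_ge0.
have c2_neq0 : a ^+ 2 + b ^+ 2 != 0.
  by rewrite gt_eqF// ltr_wpDl ?sqr_ge0// exprn_even_gt0.
have c0 : c != 0 by apply: contra_neq c2_neq0 => c0; rewrite -c2 c0 expr0n.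
rewrite !normal_pdfE ?mulf_neq0 ?invr_eq0//=.
rewrite mulrACA [RHS]mulrACA; congr (_ * _).
  have p_ge0 (s : R) : 0 <= s ^+ 2 * pi *+ 2.
    by rewrite mulrn_wge0// mulr_ge0 ?sqr_ge0 ?pi_ge0.
  rewrite /normal_peak -!invfM -!sqrtrM ?p_ge0//.
  congr (Num.sqrt _)^-1; rewrite expr_div_n c2.
  by field.
rewrite /normal_fun. rewrite -!expRD; congr expR; rewrite expr_div_n c2.
by field; rewrite c2_neq0.
Qed.

Lemma normal_prob_singleton (R : realType) (m s x : R) :
  normal_prob m s [set x] = 0%E.
Proof. by rewrite /normal_prob integral_set1. Qed.

Lemma normal_probN (R : realType) (m s : R) :
  normal_prob m (- s) = normal_prob m s.
Proof.
apply/funext => A; apply: eq_integral => x _.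
by rewrite /normal_pdf oppr_eq0 /normal_peak /normal_fun sqrrN.
Qed.

Lemma normal_prob_norm (R : realType) (m s : R) : normal_prob m `|s| = normal_prob m s.
Proof. by case: (ger0P s) => // _; rewrite normal_probN. Qed.

Lemma normal_prob_scale_norm (R : realType) (a : R) (A : set R) :
  measurable A ->
  normal_prob 0 1 ((fun w : R => `|a| * w)%R @^-1` A) =
  normal_prob 0 1 ((fun w : R => a * w)%R @^-1` A).
Proof.
move=> mA; have [->|a0] := eqVneq a 0; first by rewrite normr0.
have E b : (fun w : R => b * w)%R @^-1` A = (fun w : R => 0 + b * w)%R @^-1` A.
  by apply/seteqP; split => w /=; rewrite add0r.
by rewrite !E !normal_prob_affine ?normr_eq0// normal_prob_norm.
Qed.

Lemma integral_normal_prob_convolution (R : realType) (a b : R) (A : set R) :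
  b != 0 -> measurable A ->
  (\int[normal_prob 0 1]_u normal_prob (a * u)%R b A)%E =
  normal_prob 0 (Num.sqrt (a ^+ 2 + b ^+ 2)) A.
Proof.
move=> b0 mA; set c := Num.sqrt _.
(* The mean varies with [z.1]; translating it into the argument leaves a density with fixed
   parameters. *)
have mpdf : measurable_fun [set: R * R] (fun z : R * R => normal_pdf (a * z.1) b z.2).
  rewrite (_ : (fun z => _) = (fun z : R * R => normal_pdf 0 b (z.2 - a * z.1))).
    apply: measurableT_comp; first exact: measurable_normal_pdf.
    by apply: measurable_funB => //; exact: measurable_funM.
  by apply/funext => z; rewrite !normal_pdfE//= /normal_fun subr0.
pose k (z : R * R) := (((\1_A z.2 * normal_pdf (a * z.1) b z.2)) * normal_pdf 0 1 z.1)%R.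
have k0 z : 0 <= k z by rewrite !mulr_ge0 ?normal_pdf_ge0.
have mk : measurable_fun [set: R * R] k.
  apply: measurable_funM; last first.
    by apply: measurableT_comp => //; exact: measurable_normal_pdf.
  apply: measurable_funM => //.
  by apply: (@measurableT_comp _ _ _ _ _ _ (\1_A : R -> R)).
have mk' : measurable_fun [set: R * R] (EFin \o k) by exact/measurable_EFinP.
have probE m s : normal_prob m s A =
    (\int[lebesgue_measure]_y (\1_A y * normal_pdf m s y)%:E)%E.
  rewrite /normal_prob integral_mkcond; apply: eq_integral => y _.
  rewrite patchE indicE; case: ifP => _; by rewrite ?mul1r ?mul0r.
have mprob : measurable_fun [set: R] (fun u => normal_prob (a * u)%R b A).
  under eq_fun do rewrite probE.
  pose g (z : R * R) := (\1_A z.2 * normal_pdf (a * z.1) b z.2)%:E.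
  have mg : measurable_fun [set: R * R] g.
    apply/measurable_EFinP; apply: measurable_funM => //.
    by apply: (@measurableT_comp _ _ _ _ _ _ (\1_A : R -> R)).
  have g0 z : (0 <= g z)%E by rewrite lee_fin mulr_ge0 ?normal_pdf_ge0.
  exact: (@measurable_fun_fubini_tonelli_F _ _ _ _ _ lebesgue_measure g mg g0).
rewrite integral_normal_prob//.
transitivity (\int[lebesgue_measure]_u \int[lebesgue_measure]_y (EFin \o k) (u, y))%E.
  apply: eq_integral => u _; rewrite probE -ge0_integralZr//.
  - apply/measurable_EFinP; apply: measurable_funM => //.
    exact: measurable_normal_pdf.
  - by move=> y _; rewrite lee_fin mulr_ge0 ?normal_pdf_ge0.
  - by rewrite lee_fin normal_pdf_ge0.
rewrite fubini_tonelli//.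
rewrite probE; apply: eq_integral => y _.
under eq_integral => u _.
  rewrite /= /k /= -mulrA normal_pdf_convolution// mulrA EFinM; over.
rewrite /= ge0_integralZl//.
- by rewrite integral_normal_pdf mule1.
- by apply/measurable_EFinP; exact: measurable_normal_pdf.
- by move=> u _; rewrite lee_fin normal_pdf_ge0.
- by rewrite lee_fin mulr_ge0 ?normal_pdf_ge0.
Qed.

(** Writing every law as an affine image of the standard normal keeps the statement valid for zero
    coefficients, where the law is a point mass. *)
Lemma normal_prob_stability (R : realType) (k a b : R) (A : set R) :
  measurable A ->
  (\int[normal_prob 0 1]_u
     normal_prob 0 1 [set w : R | A (k + a * u + b * w)%R])%E =
  normal_prob 0 1 [set w : R | A (k + Num.sqrt (a ^+ 2 + b ^+ 2) * w)%R].
Proof.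
move=> mA.
have mA' : measurable ((fun y : R => k + y)%R @^-1` A).
  have mk : measurable_fun [set: R] (fun y : R => k + y)%R by exact: measurable_funD.
  by rewrite -[X in measurable X]setTI; exact: mk.
(* For [b = 0] the inner probability is an indicator in [u], and the claim is that aU and |a|U have
   the same law. *)
have [->|b0] := eqVneq b 0.
  rewrite expr0n addr0 sqrtr_sqr.
  transitivity (\int[normal_prob 0 1]_u (\1_[set u : R | A (k + a * u)%R] u)%:E)%E.
    apply: eq_integral => u _; rewrite indicE.
    have [Au|Au] := pselect (A (k + a * u)%R).
      rewrite mem_set// (_ : [set _ | _] = setT) ?probability_setT//.
      by apply/seteqP; split => // w _ /=; rewrite mul0r addr0.
    rewrite memNset// (_ : [set _ | _] = set0) ?measure0//.
    by apply/seteqP; split => // w /=; rewrite mul0r addr0.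
  rewrite integral_indic// ?setIT; last first.
    rewrite -[X in measurable X]setTI; exact: measurable_affine.
  exact/esym/(normal_prob_scale_norm a mA').
have c0 : Num.sqrt (a ^+ 2 + b ^+ 2) != 0.
  by rewrite sqrtr_eq0 -ltNge ltr_wpDl ?sqr_ge0// exprn_even_gt0.
transitivity (\int[normal_prob 0 1]_u
    normal_prob (a * u)%R b ((fun y : R => k + y)%R @^-1` A))%E.
  apply: eq_integral => u _; rewrite -(@normal_prob_affine _ (a * u) b)//.
  apply: (congr1 (normal_prob 0 1)).
  by apply/seteqP; split => w /=; rewrite addrA.
rewrite integral_normal_prob_convolution// -(@normal_prob_affine _ 0 (Num.sqrt _))//.
by apply: (congr1 (normal_prob 0 1)); apply/seteqP; split => w /=; rewrite add0r.
Qed.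

Lemma integral_normal_prob_affine (R : realType) (m s : R) (f : R -> \bar R) :
  s != 0 -> measurable_fun [set: R] f -> (forall u, 0 <= f u)%E ->
  (\int[normal_prob m s]_u f u = \int[normal_prob 0 1]_w f (m + s * w)%R)%E.
Proof.
move=> s0 mf f0.
transitivity (\int[pushforward (normal_prob 0 1)
    (fun w : measurableTypeR R => (m + s * w)%R : measurableTypeR R)]_u f u)%E.
  apply: eq_measure_integral => [|? A mA _]; first exact: measurable_affine.
  exact/esym/normal_prob_affine.
by rewrite (ge0_integral_pushforward (measurable_affine m s)).
Qed.

Lemma normal_prob_itv_gt0 (R : realType) (a b : R) : a < b ->
  (0 < normal_prob 0 1 `]a, b])%E.
Proof.
move=> ab; rewrite /normal_prob.
(* On the interval, x^2 is at most its larger endpoint value [M], so [c] is a positive lower bound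
   of the density. *)
pose M := Num.max (a ^+ 2) (b ^+ 2).
pose c := normal_peak (1 : R) * expR (- M / 2).
have c0 : 0 < c by rewrite mulr_gt0 ?normal_peak_gt0 ?expR_gt0.
apply: (@lt_le_trans _ _ (\int[lebesgue_measure]_(x in `]a, b]) c%:E)%E).
  rewrite integral_cst//= lebesgue_measure_itv/= lte_fin ab -EFinD -EFinM lte_fin.
  by rewrite mulr_gt0// subr_gt0.
apply: ge0_le_integral => //=.
- by move=> x _; rewrite lee_fin ltW.
- by apply: measurable_funTS; apply/measurable_EFinP; exact: measurable_normal_pdf.
move=> x; rewrite in_itv/= => /andP[ax xb].
rewrite lee_fin normal_pdfE//= /normal_fun subr0 expr1n.
rewrite ler_pM2l ?normal_peak_gt0// ler_expR ler_pM2r ?invr_gt0// lerN2 /M le_max.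
by apply/orP; have [x0|x0] := leP 0 x; [right|left]; nra.
Qed.

(** * Gaussian vectors *)

Lemma measurable_vec_cons (R : realType) (D : nat) :
  measurable_fun [set: measurableTypeR R * vec R D]
    (fun z : measurableTypeR R * vec R D => [tuple of z.1 :: z.2]).
Proof. exact: measurable_tuple_cons. Qed.

Lemma integral_gaussianS (R : realType) (s : R) (D : nat) (m : vec R D.+1)
    (f : vec R D.+1 -> \bar R) :
  measurable_fun [set: vec R D.+1] f -> (forall z, 0 <= f z)%E ->
  (\int[gaussian s m]_z f z =
   \int[normal_prob (thead m) s]_u
     \int[gaussian s (behead_tuple m)]_v f [tuple of u :: v])%E.
Proof.
move=> mf f0.
rewrite (ge0_integral_pushforward (@measurable_vec_cons R D))//.
rewrite (fubini_tonelli1 (f \o @tuple_cons R D))//.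
  by apply: measurableT_comp => //; exact: measurable_tuple_cons.
by move=> z; exact: f0.
Qed.

Lemma measurable_vec_tnth (R : realType) (D : nat) (i : 'I_D) :
  measurable_fun [set: vec R D] (fun z : vec R D => tnth z i : R).
Proof. exact: measurable_tnth. Qed.

Lemma measurable_dot (R : realType) (D : nat) (w : vec R D) :
  measurable_fun [set: vec R D] (dot w).
Proof.
apply: measurable_sum => i; apply: measurable_funM => //.
exact: measurable_vec_tnth.
Qed.

Lemma measurable_dot_set (R : realType) (D : nat) (w : vec R D) (A : set R) :
  measurable A -> measurable [set z : vec R D | A (dot w z)].
Proof.
by move=> mA; rewrite -[X in measurable X]setTI; exact: measurable_dot.
Qed.

Lemma dot_cons (R : realType) (D : nat) (w : vec R D.+1) (u : R) (v : vec R D) :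
  dot w [tuple of u :: v] = thead w * u + dot (behead_tuple w) v.
Proof.
rewrite /dot big_ord_recl; congr (_ + _).
by apply: eq_bigr => i _; rewrite [in LHS](tuple_eta w) !tnthS.
Qed.

Lemma vec0_eq (R : realType) (u v : vec R 0) : u = v.
Proof. by rewrite (tuple0 u) (tuple0 v). Qed.

Lemma l2norm_ge0 (R : realType) (D : nat) (w : vec R D) : 0 <= l2norm w.
Proof. exact: sqrtr_ge0. Qed.

Lemma dot_ge0 (R : realType) (D : nat) (w : vec R D) : 0 <= dot w w.
Proof. by apply: sumr_ge0 => i _; rewrite -expr2 sqr_ge0. Qed.

Lemma l2norm_sqr (R : realType) (D : nat) (w : vec R D) : l2norm w ^+ 2 = dot w w.
Proof. by rewrite sqr_sqrtr// dot_ge0. Qed.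

(** Conditionally on the first coordinate, the induction hypothesis makes the rest of the sum
    normal; stability then merges the two independent contributions. The affine form on the right
    also covers [w = 0], and so the base case. *)
Lemma gaussian_dot (R : realType) (s : R) (D : nat) (m w : vec R D) (A : set R) :
  0 < s -> measurable A ->
  gaussian s m [set z | A (dot w z)] =
  normal_prob 0 1 [set v : R | A (dot w m + s * l2norm w * v)].
Proof.
move=> s0 mA; elim: D m w A mA => [|D IH] m w A mA.
  rewrite /l2norm (_ : dot w w = 0) ?sqrtr0 ?mulr0; last by rewrite /dot big_ord0.
  have E z : dot w z = 0 by rewrite /dot big_ord0.
  under eq_set do rewrite E.
  under [in RHS]eq_set do rewrite E mul0r addr0.
  have [A0|A0] := pselect (A 0).
    rewrite (_ : [set z : vec R 0 | A 0] = setT); last by apply/seteqP; split.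
    by rewrite (_ : [set z : R | A 0] = setT) ?probability_setT//; apply/seteqP; split.
  rewrite (_ : [set z : vec R 0 | A 0] = set0); last by apply/seteqP; split.
  by rewrite (_ : [set z : R | A 0] = set0) ?measure0//; apply/seteqP; split.
have mS := measurable_dot_set w mA.
pose f (z : vec R D.+1) : \bar R := (\1_[set z | A (dot w z)] z)%:E.
have mf : measurable_fun [set: vec R D.+1] f by apply/measurable_EFinP.
have f0 z : (0 <= f z)%E by rewrite lee_fin.
transitivity (\int[gaussian s m]_z f z)%E; first by rewrite integral_indic ?setIT.
rewrite integral_gaussianS//.
rewrite integral_normal_prob_affine ?gt_eqF//; last 2 first.
- pose g (z : measurableTypeR R * vec R D) := f [tuple of z.1 :: z.2].
  have mg : measurable_fun setT g.
    by apply: measurableT_comp => //; exact: measurable_tuple_cons.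
  have g0 z : (0 <= g z)%E by exact: f0.
  exact: (@measurable_fun_fubini_tonelli_F _ _ _ _ _ (gaussian s _) g mg g0).
- by move=> u; apply: integral_ge0 => v _; exact: f0.
set w' := behead_tuple w; set m' := behead_tuple m.
have -> : dot w m = thead w * thead m + dot w' m'.
  by rewrite [m in LHS]tuple_eta dot_cons.
(* Pythagoras, in the shape that the stability lemma produces. *)
have -> : s * l2norm w = Num.sqrt ((thead w * s) ^+ 2 + (s * l2norm w') ^+ 2).
  have -> : (thead w * s) ^+ 2 + (s * l2norm w') ^+ 2 =
      s ^+ 2 * (thead w ^+ 2 + l2norm w' ^+ 2) by ring.
  rewrite sqrtrM ?sqr_ge0// sqrtr_sqr gtr0_norm// l2norm_sqr; congr (_ * Num.sqrt _).
  by rewrite [X in dot _ X]tuple_eta dot_cons expr2.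
rewrite -normal_prob_stability//; apply: eq_integral => u _.
have mA' : measurable ((fun y : R => thead w * (thead m + s * u) + y)%R @^-1` A).
  have mk : measurable_fun [set: R]
    (fun y : R => thead w * (thead m + s * u) + y)%R by exact: measurable_funD.
  by rewrite -[X in measurable X]setTI; exact: mk.
transitivity (gaussian s m' [set v | A (thead w * (thead m + s * u) + dot w' v)]).
  set S := [set v | _].
  transitivity (\int[gaussian s m']_v (\1_S v)%:E)%E.
    apply: eq_integral => v _; rewrite /f !indicE; congr ((nat_of_bool _)%:R%:E).
    by apply/idP/idP; rewrite !inE /S/= dot_cons.
  rewrite integral_indic ?setIT//.
  exact: (measurable_dot_set w' mA').
rewrite (IH m' w' _ mA').
have E (v : R) : thead w * (thead m + s * u) + (dot w' m' + s * l2norm w' * v) =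
  thead w * thead m + dot w' m' + thead w * s * u + s * l2norm w' * v by ring.
by apply: (congr1 (normal_prob 0 1)); apply/seteqP; split => v /=; rewrite E.
Qed.

(** * Inner products, distances and spheres *)

Section vectors.
Context (R : realType) (D : nat).
Implicit Types (u v w m z : vec R D).

Lemma dot_vsubr w u v : dot w (vsub u v) = dot w u - dot w v.
Proof.
by rewrite /dot -sumrB; apply: eq_bigr => i _; rewrite tnth_mktuple mulrBr.
Qed.

Lemma dot_midpointr w u v : dot w (midpoint u v) = (dot w u + dot w v) / 2.
Proof.
rewrite /dot -big_split/= mulr_suml; apply: eq_bigr => i _.
by rewrite tnth_mktuple; ring.
Qed.

(** This isolates the dependence of the Gaussian log-likelihood ratio on [z]: it is affine in the
    inner product with [vsub m' m], so level sets are hyperplanes. *)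
Lemma dot_vsub_midpoint m m' z :
  dot (vsub m' m) (vsub z (midpoint m m')) =
  dot (vsub m' m) z - dot (vsub m' m) m - l2norm (vsub m' m) ^+ 2 / 2.
Proof.
rewrite dot_vsubr dot_midpointr l2norm_sqr [in RHS]dot_vsubr.
by field.
Qed.

Lemma l2norm_vsub_eq0 u v : l2norm (vsub u v) = 0 -> u = v.
Proof.
move=> /eqP; rewrite sqrtr_eq0 => uv0; apply/eq_from_tnth => i.
have : dot (vsub u v) (vsub u v) == 0 by rewrite eq_le uv0 dot_ge0.
rewrite psumr_eq0; last by move=> j _; rewrite -expr2 sqr_ge0.
move=> /allP/(_ i (mem_index_enum _)).
by rewrite implyTb -expr2 sqrf_eq0 tnth_mktuple subr_eq0 => /eqP.
Qed.

Definition vshift m (k : R) w : vec R D :=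
  [tuple (tnth m i + k * tnth w i : R) | i < D].

Lemma dot_vshift u m k w : dot u (vshift m k w) = dot u m + k * dot u w.
Proof.
rewrite /dot mulr_sumr -big_split/=; apply: eq_bigr => i _.
by rewrite tnth_mktuple; ring.
Qed.

Lemma l2norm_vsub_vshift m k w : l2norm (vsub (vshift m k w) m) = `|k| * l2norm w.
Proof.
rewrite /l2norm -sqrtr_sqr -sqrtrM ?sqr_ge0//; congr Num.sqrt.
rewrite /dot mulr_sumr; apply: eq_bigr => i _.
by rewrite !tnth_mktuple; ring.
Qed.

(** Needed because [V] is an infimum over a sphere, which must not be empty. *)
Lemma sphere_nonempty m (r : R) : (0 < D)%N -> 0 <= r ->
  exists m', l2norm (vsub m' m) = r.
Proof.
move=> D0 r_ge0; pose i0 := Ordinal D0.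
pose e0 : vec R D := [tuple ((i == i0)%:R : R) | i < D].
exists (vshift m r e0); rewrite l2norm_vsub_vshift ger0_norm//.
suff -> : l2norm e0 = 1 by rewrite mulr1.
rewrite /l2norm /dot (bigD1 i0)//= big1 ?addr0 ?tnth_mktuple ?eqxx ?mulr1 ?sqrtr1//.
by move=> i /negbTE i_neq; rewrite !tnth_mktuple i_neq mul0r.
Qed.

End vectors.

(** * Gaussian densities and change of mean *)

Lemma gaussian_pdf_gt0 (R : realType) (s : R) (D : nat) (v : vec R D) :
  0 < s -> 0 < gaussian_pdf s v.
Proof.
move=> s0; apply: prodr_gt0 => i _; rewrite normal_pdfE ?gt_eqF//.
by rewrite mulr_gt0 ?normal_peak_gt0 ?expR_gt0 ?gt_eqF.
Qed.

Lemma gaussian_pdf_ratio (R : realType) (s : R) (D : nat) (m m' z : vec R D) :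
  0 < s ->
  gaussian_pdf s (vsub z m') / gaussian_pdf s (vsub z m) =
  expR ((s ^+ 2)^-1 * dot (vsub m' m) (vsub z (midpoint m m'))).
Proof.
move=> s0; rewrite /gaussian_pdf -prodf_div /dot mulr_sumr expR_sum.
apply: eq_bigr => i _; rewrite !tnth_mktuple !normal_pdfE ?gt_eqF//=.
have p0 : normal_peak s != 0 by rewrite gt_eqF// normal_peak_gt0 ?gt_eqF.
rewrite -mulf_div divff// mul1r /normal_fun -expRB; congr expR.
by field; rewrite gt_eqF.
Qed.

Lemma gaussian_pdf_vsubS (R : realType) (s : R) (D : nat) (u : R) (v : vec R D)
    (m : vec R D.+1) : s != 0 ->
  gaussian_pdf s (vsub [tuple of u :: v] m) =
  normal_pdf (thead m) s u * gaussian_pdf s (vsub v (behead_tuple m)).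
Proof.
move=> s0; rewrite /gaussian_pdf big_ord_recl tnth_mktuple tnth0; congr (_ * _).
  by rewrite !normal_pdfE// /normal_fun subr0.
apply: eq_bigr => i _; rewrite !tnth_mktuple; congr normal_pdf.
by rewrite [in LHS](tuple_eta m) !tnthS.
Qed.

(** [gaussian] is built by iterated products rather than from a density, so the change of measure is
    proved coordinate by coordinate: the induction hypothesis handles the tail, and one-dimensional
    densities handle the head. *)
Lemma integral_gaussian_shift (R : realType) (s : R) (D : nat) (m m' : vec R D)
    (f : vec R D -> \bar R) : 0 < s ->
  measurable_fun [set: vec R D] f -> (forall z, 0 <= f z)%E ->
  (\int[gaussian s m']_z f z = \int[gaussian s m]_z (f z *
    (gaussian_pdf s (vsub z m') / gaussian_pdf s (vsub z m))%:E))%E.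
Proof.
move=> s0; elim: D m m' f => [|D IH] m m' f mf f0.
  rewrite (vec0_eq m' m); apply: eq_integral => z _.
  by rewrite divff ?mule1// gt_eqF// gaussian_pdf_gt0.
have mr : measurable_fun [set: vec R D.+1]
    (fun z => (gaussian_pdf s (vsub z m') / gaussian_pdf s (vsub z m))%R).
  under eq_fun do rewrite gaussian_pdf_ratio//.
  apply: measurableT_comp => //; apply: measurable_funM => //.
  under eq_fun do rewrite dot_vsubr.
  by apply: measurable_funB => //; exact: measurable_dot.
have r0 k (a b : vec R k) : 0 <= gaussian_pdf s a / gaussian_pdf s b.
  by rewrite divr_ge0// ltW// gaussian_pdf_gt0.
pose fr (z : vec R D.+1) :=
  (f z * (gaussian_pdf s (vsub z m') / gaussian_pdf s (vsub z m))%:E)%E.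
have mfr : measurable_fun [set: vec R D.+1] fr.
  by apply: emeasurable_funM => //; exact/measurable_EFinP.
have fr0 z : (0 <= fr z)%E by rewrite mule_ge0// lee_fin.
transitivity (\int[gaussian s m]_z fr z)%E; last by [].
apply: (etrans (integral_gaussianS s m' mf f0)).
apply: (etrans _ (esym (integral_gaussianS s m mfr fr0))).
pose G (u : R) := (\int[gaussian s (behead_tuple m')]_v f [tuple of u :: v])%E.
pose g (z : measurableTypeR R * vec R D) := f [tuple of z.1 :: z.2].
have mg : measurable_fun setT g.
  by apply: measurableT_comp => //; exact: measurable_tuple_cons.
have g0 z : (0 <= g z)%E by exact: f0.
have mG : measurable_fun [set: R] G.
  exact: (@measurable_fun_fubini_tonelli_F _ _ _ _ _ (gaussian s _) g mg g0).
have G0 u : (0 <= G u)%E by apply: integral_ge0 => v _; exact: f0.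
have mN k : measurable_fun [set: R] (normal_pdf k s) by exact: measurable_normal_pdf.
have pdf_gt0 k u : 0 < normal_pdf k s u.
  by rewrite normal_pdfE ?gt_eqF// mulr_gt0 ?normal_peak_gt0 ?expR_gt0 ?gt_eqF.
have mfv u : measurable_fun [set: vec R D] (fun v : vec R D => f [tuple of u :: v]).
  apply: measurableT_comp => //.
  exact: (measurable_cons (measurable_cst u) (@measurable_id _ _ setT)).
transitivity (\int[normal_prob (thead m) s]_u
    (G u * (normal_pdf (thead m') s u / normal_pdf (thead m) s u)%:E))%E; last first.
  apply: eq_integral => u _; rewrite /G (IH (behead_tuple m) (behead_tuple m'))//.
  rewrite -ge0_integralZr//.
  - apply: eq_integral => v _; rewrite /fr !gaussian_pdf_vsubS ?gt_eqF// -muleA -EFinM.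
    by rewrite -mulf_div [X in (_ * X%:E)%E]mulrC.
  - apply: emeasurable_funM => //; apply/measurable_EFinP.
    under eq_fun do rewrite gaussian_pdf_ratio//.
    apply: measurableT_comp => //; apply: measurable_funM => //.
    under eq_fun do rewrite dot_vsubr.
    by apply: measurable_funB => //; exact: measurable_dot.
  - by move=> v _; rewrite mule_ge0// lee_fin.
  - by rewrite lee_fin divr_ge0// ltW.
pose Gr u := (G u * (normal_pdf (thead m') s u / normal_pdf (thead m) s u)%:E)%E.
have mGr : measurable_fun [set: R] Gr.
  apply: emeasurable_funM => //; apply/measurable_EFinP; apply: measurable_funM => //.
  (* The reciprocal of the density is again an exponential, which makes its measurability
     immediate. *)
  rewrite (_ : (fun u => _) = fun u => (normal_peak s)^-1 *
      expR ((u - thead m) ^+ 2 / (s ^+ 2 *+ 2))).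
    apply: measurable_funM => //; apply: measurableT_comp => //.
    apply: measurable_funM => //; apply: measurable_funX => //.
    exact: measurable_funB.
  apply/funext => u; rewrite normal_pdfE ?gt_eqF//= invfM; congr (_ * _).
  by rewrite /normal_fun mulNr expRN invrK.
have Gr0 u : (0 <= Gr u)%E by rewrite mule_ge0// lee_fin divr_ge0// ltW.
(* Both sides become Lebesgue integrals, where the density in the denominator cancels because it is
   positive. *)
apply: (etrans (integral_normal_prob (thead m') s mG G0)).
apply: (etrans _ (esym (integral_normal_prob (thead m) s mGr Gr0))).
apply: eq_integral => u _; rewrite /Gr -muleA -EFinM divfK//.
by rewrite gt_eqF.
Qed.

(** * The extended normal cdf and Gaussian half-spaces *)

Lemma Phi_measurable_set (R : realType) (u : \bar R) :
  measurable [set w : measurableTypeR R | ((w : R)%:E <= u)%E].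
Proof.
case: u => [u| |].
- have -> : [set w : measurableTypeR R | ((w : R)%:E <= u%:E)%E] = `]-oo, u]%classic.
    by apply/seteqP; split => w /=; rewrite in_itv/= lee_fin.
  exact: measurable_itv.
- have -> : [set w : measurableTypeR R | ((w : R)%:E <= +oo)%E] = setT.
    by apply/seteqP; split => w //= _; rewrite leey.
  exact: measurableT.
- have -> : [set w : measurableTypeR R | ((w : R)%:E <= -oo)%E] = set0.
    by apply/seteqP; split => w //=; rewrite leeNy_eq.
  exact: measurable0.
Qed.

Lemma EFin_Phi (R : realType) (u : \bar R) :
  (Phi u)%:E = normal_prob 0 1 [set w : measurableTypeR R | ((w : R)%:E <= u)%E].
Proof. by rewrite fineK// fin_num_measure//; exact: Phi_measurable_set. Qed.

Lemma Phi_pinfty (R : realType) : Phi (+oo%E : \bar R) = 1.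
Proof.
apply: EFin_inj; rewrite EFin_Phi (_ : [set _ | _] = setT) ?probability_setT//.
by apply/seteqP; split => w //= _; rewrite leey.
Qed.

Lemma Phi_ge0 (R : realType) (u : \bar R) : 0 <= Phi u.
Proof. by rewrite -lee_fin EFin_Phi. Qed.

Lemma le_Phi (R : realType) (u v : \bar R) : (u <= v)%E -> Phi u <= Phi v.
Proof.
move=> uv; rewrite -lee_fin !EFin_Phi.
apply: le_measure; rewrite ?inE; [exact: Phi_measurable_set..|].
by move=> w /= /le_trans; exact.
Qed.

Section halfspaces.
Context (R : realType) (s : R) (D : nat) (m w : vec R D).
Hypotheses (s0 : 0 < s) (w0 : 0 < l2norm w).

Let sw0 : 0 < s * l2norm w. Proof. exact: mulr_gt0. Qed.

Lemma gaussian_halfspace (c : R) :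
  gaussian s m [set z | dot w z <= c] =
  (Phi ((c - dot w m) / (s * l2norm w))%:E)%:E.
Proof.
rewrite EFin_Phi (_ : [set z | dot w z <= c] = [set z | `]-oo, c]%classic (dot w z)]).
  rewrite gaussian_dot//; apply: (congr1 (normal_prob 0 1)).
  apply/seteqP; split => v /=; rewrite in_itv/= lee_fin ler_pdivlMr// mulrC;
    by rewrite lerBrDr addrC.
by apply/seteqP; split => v /=; rewrite in_itv.
Qed.

Lemma gaussian_hyperplane (c : R) : gaussian s m [set z | dot w z = c] = 0%E.
Proof.
rewrite (gaussian_dot m w s0 (measurable_set1 c)).
rewrite -[RHS](normal_prob_singleton 0 1 ((c - dot w m) / (s * l2norm w))).
apply: (congr1 (normal_prob 0 1)); apply/seteqP; split => v /=.
  by move=> <-; rewrite addrAC subrr add0r mulrC mulKf// gt_eqF.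
by move=> ->; rewrite mulrC divfK ?gt_eqF// addrC subrK.
Qed.

Lemma gaussian_slab_gt0 (c c' : R) : c < c' ->
  (0 < gaussian s m [set z | (c < dot w z <= c')%R])%E.
Proof.
move=> cc'; rewrite (_ : [set z | _] = [set z | `]c, c']%classic (dot w z)]).
  rewrite gaussian_dot//.
  have -> : [set v : R | `]c, c']%classic (dot w m + s * l2norm w * v)%R] =
      `](c - dot w m) / (s * l2norm w), (c' - dot w m) / (s * l2norm w)]%classic.
    apply/seteqP; split => v /=; rewrite !in_itv/= ltr_pdivrMr// ler_pdivlMr//;
      by rewrite ltrBlDl lerBrDl (mulrC v).
  by apply: normal_prob_itv_gt0; rewrite ltr_pM2r ?invr_gt0// ltrD2r.
by apply/seteqP; split => v /=; rewrite in_itv.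
Qed.

End halfspaces.

(** * Discrete sums, Neyman-Pearson tests and levels of a distribution *)

(** An injection into the naturals partitions the space into fibres, each empty or a singleton, and
    the integral is additive over this partition. *)
Lemma integral_countable (R : realType) (d : measure_display)
    (X : measurableType d) (q : probability X R) (f : X -> \bar R) :
  countable [set: X] -> (forall A : set X, measurable A) ->
  (forall x, 0 <= f x)%E ->
  (\int[q]_x f x = \esum_(x in [set: X]) (f x * q [set x]))%E.
Proof.
move=> /countable_injP[e einj] mX f0.
have inj x y : e x = e y -> x = y by move=> exy; apply: einj; rewrite ?in_setT.
pose E k := e @^-1` [set k].
have UE : [set: X] = \bigcup_k E k.
  by apply/seteqP; split => // x _; exists (e x).
have tE : trivIset setT E by exact: trivIset_preimage1.
have a0 x : (0 <= f x * q [set x])%E by rewrite mule_ge0.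
rewrite [in LHS]UE ge0_integral_bigcup//.
rewrite UE esum_bigcupT// nneseries_esumT; last by move=> k; exact: integral_ge0.
apply: eq_esum => k _; have [[x Ekx]|Ek] := pselect (exists x, E k x).
  have -> : E k = [set x].
    apply/seteqP; split => [y Eky|y ->//]; apply: inj.
    by rewrite (Eky : e y = k) (Ekx : e x = k).
  rewrite esum_set1// (eq_integral (cst (f x))); last first.
    by move=> y; rewrite inE => ->.
  by rewrite integral_cst.
rewrite (_ : E k = set0) ?integral_set0 ?esum_set0//.
by apply/seteqP; split => // x Ekx; apply: Ek; exists x.
Qed.

Lemma measurable_le_level (R : realType) (d : measure_display)
    (T : measurableType d) (g : T -> R) (t : R) :
  measurable_fun [set: T] g -> measurable [set z | g z <= t].
Proof.
move=> mg; rewrite (_ : [set z | _] = g @^-1` `]-oo, t]%classic); last first.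
  by apply/seteqP; split => z /=; rewrite in_itv.
by rewrite -[X in measurable X]setTI; exact: mg.
Qed.

Lemma measurable_eq_level (R : realType) (d : measure_display)
    (T : measurableType d) (g : T -> R) (t : R) :
  measurable_fun [set: T] g -> measurable [set z | g z = t].
Proof.
move=> mg; rewrite (_ : [set z | _] = g @^-1` [set t])//.
by rewrite -[X in measurable X]setTI; exact: mg.
Qed.

Section neyman_pearson.
Context (R : realType) (d : measure_display) (T : measurableType d).
Context (P Q : probability T R) (g : T -> R) (t : R).
Hypotheses (mg : measurable_fun [set: T] g) (g0 : forall z, 0 <= g z) (t0 : 0 <= t).
Hypothesis Qg : forall f : T -> \bar R, measurable_fun [set: T] f ->
  (forall z, 0 <= f z)%E -> (\int[Q]_z f z = \int[P]_z (f z * (g z)%:E))%E.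

Let h0 : T -> R := \1_[set z | g z <= t].

Let mh0 : measurable_fun [set: T] h0.
Proof. by apply: measurable_indic; exact: measurable_le_level. Qed.

Let h00 z : 0 <= h0 z <= 1.
Proof. by rewrite /h0 indicE; case: (_ \in _) => /=; rewrite !lexx ler01. Qed.

(** Adding the term in [t] to each side, instead of subtracting it, keeps the integrands
    nonnegative. *)
Let integral_mix (h h' : T -> R) :
  measurable_fun [set: T] h -> measurable_fun [set: T] h' ->
  (forall z, 0 <= h z <= 1) -> (forall z, 0 <= h' z <= 1) ->
  (\int[P]_z (h z * g z + t * h' z)%:E =
   \int[Q]_z (h z)%:E + t%:E * \int[P]_z (h' z)%:E)%E.
Proof.
move=> mh mh' h01 h'01.
rewrite Qg//; last 2 first.
- exact/measurable_EFinP.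
- by move=> z; rewrite lee_fin; case/andP: (h01 z).
rewrite -ge0_integralZl//; last 2 first.
- exact/measurable_EFinP.
- by move=> z _; rewrite lee_fin; case/andP: (h'01 z).
rewrite -ge0_integralD//.
- by move=> z _; rewrite lee_fin mulr_ge0//; case/andP: (h01 z).
- by apply/measurable_EFinP; exact: measurable_funM.
- by move=> z _; rewrite lee_fin mulr_ge0//; case/andP: (h'01 z).
- by apply/measurable_EFinP; exact: measurable_funM.
Qed.

Let fin01 (Q' : probability T R) (h : T -> R) : measurable_fun [set: T] h ->
  (forall z, 0 <= h z <= 1) -> (\int[Q']_z (h z)%:E)%E \is a fin_num.
Proof.
move=> mh h01; rewrite ge0_fin_numE; last first.
  by apply: integral_ge0 => z _; rewrite lee_fin; case/andP: (h01 z).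
apply: (@le_lt_trans _ _ (\int[Q']_z (cst 1 z))%E); last first.
  by rewrite integral_cst// mul1e (le_lt_trans (probability_le1 Q' measurableT))// ltry.
apply: ge0_le_integral => //.
- by move=> z _; rewrite lee_fin; case/andP: (h01 z).
- exact/measurable_EFinP.
- by move=> z _; rewrite lee_fin; case/andP: (h01 z).
Qed.

(** Both factors are nonpositive where [g <= t], since [h0] is 1 there, and nonnegative elsewhere,
    since [h0] is 0. *)
Let gap_ge0 (h : T -> R) z : 0 <= h z <= 1 -> 0 <= (h z - h0 z) * (g z - t).
Proof.
rewrite /h0 indicE => /andP[h_ge0 h_le1]; have [gt|gt] := leP (g z) t.
  by rewrite mem_set// mulr1n; nra.
by rewrite memNset; [rewrite mulr0n; nra | rewrite /= leNgt gt].
Qed.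

(** The two objectives differ by the [P]-integral of [(h - h0) * g]; the equality constraint allows
    [g] to be replaced by [g - t]. *)
Let integral_gap (h : T -> R) : measurable_fun [set: T] h ->
  (forall z, 0 <= h z <= 1) ->
  (\int[P]_z (h z)%:E = \int[P]_z (h0 z)%:E)%E ->
  (\int[Q]_z (h z)%:E =
   \int[Q]_z (h0 z)%:E + \int[P]_z ((h z - h0 z) * (g z - t))%:E)%E.
Proof.
move=> mh h01 Ph.
have := integral_mix mh mh0 h01 h00.
rewrite (_ : (fun z => (h z * g z + t * h0 z)%:E) =
  (fun z => (h0 z * g z + t * h z)%:E + ((h z - h0 z) * (g z - t))%:E)%E); last first.
  by apply/funext => z; rewrite -EFinD; congr EFin; ring.
rewrite ge0_integralD//; last 4 first.
- move=> z _; have /andP[h_ge0 _] := h01 z; have /andP[h0_ge0 _] := h00 z.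
  by rewrite lee_fin addr_ge0// mulr_ge0.
- by apply/measurable_EFinP; apply: measurable_funD; exact: measurable_funM.
- by move=> z _; rewrite lee_fin gap_ge0.
- by apply/measurable_EFinP; apply: measurable_funM; exact: measurable_funB.
rewrite (integral_mix mh0 mh h00 h01) Ph addeAC.
set c := (t%:E * _)%E; have cfin : c \is a fin_num by rewrite fin_numM// fin01.
by move=> /(congr1 (fun y => y - c)%E); rewrite !addeK// => <-.
Qed.

Lemma neyman_pearson_le (h : T -> R) : measurable_fun [set: T] h ->
  (forall z, 0 <= h z <= 1) ->
  (\int[P]_z (h z)%:E = \int[P]_z (\1_[set z | g z <= t] z)%:E)%E ->
  (\int[Q]_z (\1_[set z | g z <= t] z)%:E <= \int[Q]_z (h z)%:E)%E.
Proof.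
move=> mh h01 Ph; rewrite (integral_gap mh h01 Ph) leeDl//.
by apply: integral_ge0 => z _; rewrite lee_fin gap_ge0.
Qed.

(** Equal objectives force the nonnegative gap to have integral 0, hence to vanish almost
    everywhere; off the null level [g = t] this means [h = h0]. *)
Lemma neyman_pearson_ae (h : T -> R) : measurable_fun [set: T] h ->
  (forall z, 0 <= h z <= 1) -> P [set z | g z = t] = 0%E ->
  (\int[P]_z (h z)%:E = \int[P]_z (\1_[set z | g z <= t] z)%:E)%E ->
  (\int[Q]_z (h z)%:E = \int[Q]_z (\1_[set z | g z <= t] z)%:E)%E ->
  {ae P, forall z, h z = \1_[set z | g z <= t] z}.
Proof.
move=> mh h01 Pt Ph Qh.
have := integral_gap mh h01 Ph; rewrite Qh addeC.
move=> /(congr1 (fun y => y - \int[Q]_z (h0 z)%:E)%E).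
rewrite addeK ?subee ?(fin01 Q mh0 h00)// => /esym k0.
have mgap : measurable_fun [set: T] (fun z => ((h z - h0 z) * (g z - t))%:E).
  by apply/measurable_EFinP; apply: measurable_funM; exact: measurable_funB.
have /(ae_eq_integral_abs P measurableT mgap)ae0 :
    (\int[P]_z `|((h z - h0 z) * (g z - t))%:E| = 0)%E.
  by rewrite -[RHS]k0; apply: eq_integral => z _; rewrite gee0_abs// lee_fin gap_ge0.
have aet : {ae P, forall z, g z <> t}.
  exists [set z | g z = t]; split => //; last by move=> z /= /contrapT.
  exact: measurable_eq_level.
apply: filterS2 ae0 aet => z /(_ I)/= [] /eqP.
by rewrite mulf_eq0 => /orP[|]; rewrite subr_eq0 => /eqP.
Qed.

End neyman_pearson.

(** The level is the supremum of the [t] with [G t < pA]. Right continuity of [G] gives [pA <= G t],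
    and the absence of an atom at [t] gives the converse. *)
Lemma distribution_level_exists (R : realType) (d : measure_display)
    (T : measurableType d) (P : probability T R) (g : T -> R) (pA : \bar R) :
  measurable_fun [set: T] g -> (forall t, 0 < t -> P [set z | g z = t] = 0%E) ->
  (P [set z | (g z <= 0)%R] < pA)%E -> (pA < 1)%E ->
  exists2 t : R, 0 < t & P [set z | g z <= t] = pA.
Proof.
move=> mg atoms P0 pA1.
pose G t := P [set z | g z <= t].
have mle t : measurable [set z | g z <= t] by exact: measurable_le_level.
have G_nd : {homo G : x y / x <= y >-> (x <= y)%E}.
  move=> x y xy; apply: le_measure; rewrite ?inE//.
  by move=> z /= /le_trans; exact.
pose S := [set t | (G t < pA)%E].
have S0 : S 0 by [].
(* [G] tends to 1 along the integers and [pA < 1], so [S] is bounded above. *)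
have [b Gb] : exists b, (pA <= G b)%E.
  have cG : G n%:R @[n --> \oo] --> P (\bigcup_n [set z | g z <= n%:R]).
    apply: nondecreasing_cvg_mu => //; first exact: bigcup_measurable.
    move=> m n mn; apply/subsetPset => z /= /le_trans; apply.
    by rewrite ler_nat.
  apply: contrapT => /forallNP nG.
  have : (P (\bigcup_n [set z | (g z <= n%:R)%R]) <= pA)%E.
    apply: (cvge_to_le cG) => //.
    by apply: nearW => n; rewrite ltW// ltNge; exact/negP/nG.
  rewrite (_ : \bigcup_n _ = setT) ?probability_setT 1?leNgt ?pA1//.
  apply/seteqP; split => // z _; exists (Num.truncn `|g z|).+1 => //=.
  by rewrite (le_trans (ler_norm _))// ltW// truncnS_gt.
have Sb : ubound S b.
  by move=> t St; rewrite leNgt; apply/negP => /ltW/G_nd/(le_trans Gb); rewrite leNgt St.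
have hS : has_sup S by split; [exists 0 | exists b].
pose t := sup S.
have t_ge0 : 0 <= t by apply: ub_le_sup => //; exists b.
have Gt : (pA <= G t)%E.
  have cG : G (t + n.+1%:R^-1) @[n --> \oo] -->
      P (\bigcap_n [set z | g z <= t + n.+1%:R^-1]).
    apply: nonincreasing_cvg_mu => //.
    - by rewrite -ge0_fin_numE// fin_num_measure.
    - exact: bigcap_measurable.
    - move=> m n mn; apply/subsetPset => z /= /le_trans; apply.
      by rewrite lerD2l lef_pV2 ?posrE// ler_nat.
  have -> : G t = P (\bigcap_n [set z | g z <= t + n.+1%:R^-1]).
    rewrite /G; congr (P _); apply/seteqP; split => z /=.
      by move=> gt n _ /=; rewrite (le_trans gt)// lerDl invr_ge0.
    move=> gt; apply/ler_addgt0Pr => e e0.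
    apply: (le_trans (gt (Num.truncn e^-1) I)); rewrite lerD2l.
    by rewrite invf_ple ?posrE// ltW// truncnS_gt.
  apply: (cvge_to_ge cG) => //.
  apply: nearW => n; rewrite leNgt; apply/negP => Sn.
  have : t + n.+1%:R^-1 <= t by apply: ub_le_sup => //; exists b.
  by rewrite leNgt ltrDl invr_gt0 ltr0n.
(* Positivity comes first, since only positive levels are known to be null. *)
have t0 : 0 < t.
  rewrite lt_neqAle t_ge0 andbT; apply/eqP => t0.
  by move: Gt; rewrite -t0 leNgt => /negP; exact.
exists t => //; apply/eqP; rewrite eq_le Gt andbT.
have mlt : measurable [set z | g z < t].
  rewrite (_ : [set z | _] = g @^-1` `]-oo, t[%classic); last first.
    by apply/seteqP; split => z /=; rewrite in_itv.
  by rewrite -[X in measurable X]setTI; exact: mg.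
have meq : measurable [set z | g z = t] by exact: measurable_eq_level.
rewrite (_ : [set z | g z <= t] = [set z | g z < t] `|` [set z | g z = t]); last first.
  apply/seteqP; split => z /=.
    by rewrite le_eqVlt => /orP[/eqP|]; [right | left].
  by move=> [/ltW|->].
apply: (@le_trans _ _ (P [set z | (g z < t)%R] + P [set z | g z = t])%E).
  exact: measureU2.
rewrite atoms// adde0.
have cG : G (t - n.+1%:R^-1) @[n --> \oo] -->
    P (\bigcup_n [set z | g z <= t - n.+1%:R^-1]).
  apply: nondecreasing_cvg_mu => //; first exact: bigcup_measurable.
  move=> m n mn; apply/subsetPset => z /= /le_trans; apply.
  by rewrite lerD2l lerN2 lef_pV2 ?posrE// ler_nat.
have -> : [set z | g z < t] = \bigcup_n [set z | g z <= t - n.+1%:R^-1].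
  apply/seteqP; split => z /=.
    move=> gt; exists (Num.truncn (t - g z)^-1) => //=.
    rewrite lerBrDr -lerBrDl invf_ple ?posrE ?subr_gt0// ltW//.
    exact: truncnS_gt.
  by move=> [n _ /=] /le_lt_trans; apply; rewrite ltrBlDr ltrDl invr_gt0.
apply: (cvge_to_le cG) => //.
(* Below the supremum there is an element of [S] above [t - 1/(n+1)], and [G] is monotone. *)
apply: nearW => n.
have : t - n.+1%:R^-1 < t by rewrite ltrBlDr ltrDl invr_gt0.
by move=> /(sup_gt hS.1)[u Su /ltW/G_nd] /le_trans; apply; exact: ltW.
Qed.

(** * Hybrid smoothing *)

Section smoothing.
Context (R : realType) (d1 : measure_display) (X1 : measurableType d1).
Hypotheses (X1_countable : countable [set: X1])
  (X1_discrete : forall A : set X1, measurable A).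
Context (D : nat) (s : R) (p1 : X1 -> probability X1 R).
Hypothesis s0 : 0 < s.
Local Notation XV := (X1 * vec R D)%type.
Implicit Types (y : XV) (h : XV -> R) (a b : X1) (m : vec R D).

Lemma measurable_fun_discrete (d' : measure_display) (T : measurableType d')
  (g : X1 -> T) : measurable_fun [set: X1] g.
Proof. by move=> _ A _; exact: X1_discrete. Qed.

Lemma EFin_mass b (z1 : X1) : p1 b [set z1] = (mass (p1 b) z1)%:E.
Proof. by rewrite /mass fineK// fin_num_measure. Qed.

Lemma mass_ge0 b (z1 : X1) : 0 <= mass (p1 b) z1.
Proof. by rewrite fine_ge0. Qed.

Lemma integral_law y (f : XV -> \bar R) :
  measurable_fun [set: XV] f -> (forall z, 0 <= f z)%E ->
  (\int[law p1 s y]_z f z =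
   \int[p1 y.1]_z1 \int[gaussian s y.2]_z2 f (z1, z2))%E.
Proof. by move=> mf f0; rewrite /law fubini_tonelli1. Qed.

Lemma smoothedE y h : smoothed p1 s y h = (\int[law p1 s y]_z (h z)%:E)%E.
Proof. by rewrite /smoothed expectation.unlock. Qed.

Lemma measurable_slice (A : set XV) (z1 : X1) : measurable A ->
  measurable [set z2 | A (z1, z2)].
Proof.
move=> mA; rewrite (_ : [set _ | _] = xsection A z1); first exact: measurable_xsection.
by apply/seteqP; split => z2 /=; rewrite /xsection/= inE.
Qed.

Lemma law_slices y (A : set XV) : measurable A ->
  law p1 s y A = (\int[p1 y.1]_z1 gaussian s y.2 [set z2 | A (z1, z2)])%E.
Proof.
move=> mA.
transitivity (\int[law p1 s y]_z (\1_A z)%:E)%E; first by rewrite integral_indic// setIT.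
rewrite integral_law//; last exact/measurable_EFinP.
apply: eq_integral => z1 _.
transitivity (\int[gaussian s y.2]_z2 (\1_[set z2 | A (z1, z2)] z2)%:E)%E.
  apply: eq_integral => z2 _; rewrite !indicE.
  by have [Az|Az] := pselect (A (z1, z2)); [rewrite !mem_set | rewrite !memNset].
by rewrite integral_indic ?setIT//; exact: measurable_slice.
Qed.

Lemma discrete_null b (A : set X1) : (forall z1, A z1 -> mass (p1 b) z1 = 0) ->
  p1 b A = 0%E.
Proof.
move=> A0; have mA := X1_discrete A.
rewrite -[A]setIT -integral_indic// integral_countable//.
apply: esum1 => z _; rewrite EFin_mass -EFinM indicE.
by have [Az|Az] := pselect (A z); [rewrite A0 ?mulr0 | rewrite memNset ?mul0r].
Qed.

(** * The likelihood ratio for a fixed discrete adversarial input *)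

Section fixed_adversary.
Context (x : XV) (a : X1).
Hypothesis abs_cont : forall z1, mass (p1 x.1) z1 = 0 -> mass (p1 a) z1 = 0.
Local Notation ga := (gamma1 p1 x a).

Lemma gamma1_ge0 (z1 : X1) : 0 <= ga z1.
Proof. by rewrite divr_ge0// mass_ge0. Qed.

(** Where the clean mass is 0 the quotient defaults to 0, and absolute continuity makes the left
    side vanish too. *)
Lemma mass_gamma1 (z1 : X1) : mass (p1 a) z1 = ga z1 * mass (p1 x.1) z1.
Proof.
rewrite /gamma1; have [m0|m0] := eqVneq (mass (p1 x.1) z1) 0; last by rewrite divfK.
by rewrite abs_cont// mul0r mul0r.
Qed.

(** Turns the sums over the clean support into integrals: [b = x.1] serves for [F], and [b = a] for
    the closed form. *)
Lemma esum_support b (g : X1 -> R) : (forall z1, 0 <= g z1) ->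
  (forall z1, mass (p1 x.1) z1 = 0 -> mass (p1 b) z1 = 0) ->
  (\esum_(z1 in [set z1 | (0 < mass (p1 x.1) z1)%R]) (mass (p1 b) z1 * g z1)%:E =
   \int[p1 b]_z1 (g z1)%:E)%E.
Proof.
move=> g0 b_ac; rewrite integral_countable// esum_mkcond; apply: eq_esum => z _.
rewrite EFin_mass -EFinM mulrC.
have [m0|m0] := ltP 0 (mass (p1 x.1) z); first by rewrite mem_set.
rewrite memNset ?b_ac ?mulr0//=; last by rewrite ltNge m0.
by apply/eqP; rewrite eq_le m0 mass_ge0.
Qed.

Lemma gamma2E m (z2 : vec R D) :
  gamma2 s x m z2 = expR ((s ^+ 2)^-1 * dot (vsub m x.2) (vsub z2 (midpoint x.2 m))).
Proof. exact: gaussian_pdf_ratio. Qed.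

Lemma measurable_gamma2 m : measurable_fun [set: vec R D] (gamma2 s x m).
Proof.
rewrite (_ : gamma2 s x m = fun z2 => expR ((s ^+ 2)^-1 *
    dot (vsub m x.2) (vsub z2 (midpoint x.2 m)))).
  apply: measurableT_comp => //; apply: measurable_funM => //.
  under eq_fun do rewrite dot_vsubr.
  by apply: measurable_funB => //; exact: measurable_dot.
by apply/funext => z2; rewrite gamma2E.
Qed.

Lemma measurable_gamma m : measurable_fun [set: XV] (gamma p1 s x (a, m)).
Proof.
apply: measurable_funM.
  by apply: (@measurableT_comp _ _ _ _ _ _ ga) => //; exact: measurable_fun_discrete.
by apply: (@measurableT_comp _ _ _ _ _ _ (gamma2 s x m)) => //; exact: measurable_gamma2.
Qed.

Lemma measurable_gamma_le m t : measurable [set z | gamma p1 s x (a, m) z <= t].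
Proof. by apply: measurable_le_level; exact: measurable_gamma. Qed.

Lemma gamma_ge0 m (z : XV) : 0 <= gamma p1 s x (a, m) z.
Proof. by rewrite mulr_ge0 ?gamma1_ge0// gamma2E expR_ge0. Qed.

(** The density hypothesis of Neyman-Pearson: the Gaussian change of mean supplies the factor
    [gamma2], and the pointwise identity of masses supplies [gamma1]. *)
Lemma integral_law_gamma m (f : XV -> \bar R) :
  measurable_fun [set: XV] f -> (forall z, 0 <= f z)%E ->
  (\int[law p1 s (a, m)]_z f z =
   \int[law p1 s x]_z (f z * (gamma p1 s x (a, m) z)%:E))%E.
Proof.
move=> mf f0.
have mfz z1 : measurable_fun [set: vec R D] (fun z2 => f (z1, z2)).
  exact: measurableT_comp.
have mf2 z1 : measurable_fun [set: vec R D]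
    (fun z2 => f (z1, z2) * (gamma2 s x m z2)%:E)%E.
  by apply: emeasurable_funM => //; apply/measurable_EFinP; exact: measurable_gamma2.
rewrite !integral_law//; last 2 first.
- by apply: emeasurable_funM => //; apply/measurable_EFinP; exact: measurable_gamma.
- by move=> z; rewrite mule_ge0// lee_fin gamma_ge0.
pose G z1 := (\int[gaussian s x.2]_z2 (f (z1, z2) * (gamma2 s x m z2)%:E))%E.
have G0 z1 : (0 <= G z1)%E.
  by apply: integral_ge0 => z2 _; rewrite mule_ge0// lee_fin gamma2E expR_ge0.
transitivity (\int[p1 a]_z1 G z1)%E.
  by apply: eq_integral => z1 _; rewrite (integral_gaussian_shift x.2).
transitivity (\int[p1 x.1]_z1 ((ga z1)%:E * G z1))%E.
  rewrite !integral_countable//; last by move=> z1; rewrite mule_ge0// lee_fin gamma1_ge0.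
  apply: eq_esum => z1 _; rewrite !EFin_mass mass_gamma1 EFinM.
  by rewrite muleCA muleA.
apply: eq_integral => z1 _; rewrite /G -ge0_integralZl//.
- by apply: eq_integral => z2 _; rewrite /gamma/= EFinM muleCA.
- by move=> z2 _; rewrite mule_ge0// lee_fin gamma2E expR_ge0.
- by rewrite lee_fin gamma1_ge0.
Qed.

(** Solving gamma = t for the inner product with Delta, after taking logarithms, on a slice with
    positive [gamma1]. *)
Definition slice_bound m (z1 : X1) (t : R) : R :=
  s ^+ 2 * (ln t - ln (ga z1)) + dot (vsub m x.2) x.2 + l2norm (vsub m x.2) ^+ 2 / 2.

Lemma gammaE m (z1 : X1) (z2 : vec R D) : 0 < ga z1 ->
  gamma p1 s x (a, m) (z1, z2) = expR (ln (ga z1) + (s ^+ 2)^-1 *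
    (dot (vsub m x.2) z2 - dot (vsub m x.2) x.2 - l2norm (vsub m x.2) ^+ 2 / 2)).
Proof.
by move=> g0; rewrite expRD lnK ?posrE// /gamma/= gamma2E dot_vsub_midpoint.
Qed.

Lemma gamma_le m (z1 : X1) (z2 : vec R D) t : 0 < ga z1 -> 0 < t ->
  (gamma p1 s x (a, m) (z1, z2) <= t) =
  (dot (vsub m x.2) z2 <= slice_bound m z1 t).
Proof.
move=> g0 t0; rewrite gammaE// -{1}(lnK t0) ler_expR -lerBrDl.
rewrite mulrC ler_pdivrMr ?exprn_gt0// mulrC /slice_bound.
by apply/idP/idP; lra.
Qed.

Lemma gamma_eq m (z1 : X1) (z2 : vec R D) t : 0 < ga z1 -> 0 < t ->
  gamma p1 s x (a, m) (z1, z2) = t -> dot (vsub m x.2) z2 = slice_bound m z1 t.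
Proof.
move=> g0 t0; rewrite gammaE// -{1}(lnK t0) /slice_bound => /expR_inj <-.
by field; rewrite gt_eqF.
Qed.

Lemma slice_bound_lt m (z1 : X1) t t' : 0 < t -> t < t' ->
  slice_bound m z1 t < slice_bound m z1 t'.
Proof.
move=> t0 tt'; rewrite /slice_bound !ltrD2r ltr_pM2l ?exprn_gt0// ltrD2r.
by rewrite ltr_ln ?posrE// (lt_trans t0).
Qed.

Lemma threshold_argE r t (z1 : X1) : 0 < t -> 0 < ga z1 ->
  threshold_arg p1 s x a t r z1 =
  ((r ^+ 2 / 2 + s ^+ 2 * (ln t - ln (ga z1))) / (s * r))%:E.
Proof. by move=> t0 g0; rewrite /threshold_arg !lne_EFin. Qed.

Lemma threshold_arg_pinfty r t (z1 : X1) : 0 < r -> 0 < t -> ga z1 = 0 ->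
  threshold_arg p1 s x a t r z1 = +oo%E.
Proof.
move=> r0 t0 g0; rewrite /threshold_arg g0 lne_EFin// le0_lneNy//=.
rewrite addey// gt0_muley ?lte_fin ?exprn_gt0// addey//.
by rewrite gt0_mulye// lte_fin invr_gt0 mulr_gt0.
Qed.

(** The mean [m'] is independent of the [m] that defines the test: [m' = x.2] leads to [F], [m' = m]
    to the closed form, and other means to monotonicity. *)
Lemma gaussian_gamma_slice m m' (z1 : X1) t : 0 < l2norm (vsub m x.2) -> 0 < t ->
  gaussian s m' [set z2 | gamma p1 s x (a, m) (z1, z2) <= t] =
  (Phi (threshold_arg p1 s x a t (l2norm (vsub m x.2)) z1 -
    ((dot (vsub m x.2) m' - dot (vsub m x.2) x.2) /
      (s * l2norm (vsub m x.2)))%:E)%E)%:E.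
Proof.
move=> r0 t0; have := gamma1_ge0 z1; rewrite le_eqVlt => /orP[/eqP/esym g0|g0].
  rewrite threshold_arg_pinfty// addye// Phi_pinfty.
  rewrite (_ : [set z2 | _] = setT) ?probability_setT//.
  by apply/seteqP; split => // z2 _ /=; rewrite /gamma/= g0 mul0r ltW.
under eq_set do rewrite gamma_le//.
rewrite (gaussian_halfspace m' s0 r0) (threshold_argE _ t0 g0) -EFinB -mulrBl.
rewrite (_ : slice_bound m z1 t - dot (vsub m x.2) m' =
  l2norm (vsub m x.2) ^+ 2 / 2 + s ^+ 2 * (ln t - ln (ga z1)) -
  (dot (vsub m x.2) m' - dot (vsub m x.2) x.2)) //.
by rewrite /slice_bound; ring.
Qed.

Lemma law_gamma_le b m m' t : 0 < l2norm (vsub m x.2) -> 0 < t ->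
  law p1 s (b, m') [set z | gamma p1 s x (a, m) z <= t] =
  (\int[p1 b]_z1 (Phi (threshold_arg p1 s x a t (l2norm (vsub m x.2)) z1 -
    ((dot (vsub m x.2) m' - dot (vsub m x.2) x.2) /
      (s * l2norm (vsub m x.2)))%:E)%E)%:E)%E.
Proof.
move=> r0 t0; rewrite law_slices; last exact: measurable_gamma_le.
by apply: eq_integral => z1 _; exact: gaussian_gamma_slice.
Qed.

Lemma smoothed_indic y (A : set XV) : measurable A ->
  smoothed p1 s y \1_A = law p1 s y A.
Proof. by move=> mA; rewrite smoothedE integral_indic// setIT. Qed.

Lemma law_F m t : 0 < l2norm (vsub m x.2) -> 0 < t ->
  law p1 s x [set z | gamma p1 s x (a, m) z <= t] =
  F p1 s x a t (l2norm (vsub m x.2)).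
Proof.
move=> r0 t0.
rewrite [in law p1 s x](surjective_pairing x) (law_gamma_le x.1 x.2 r0 t0).
apply/esym/(etrans (@esum_support x.1
  (fun z1 => Phi (threshold_arg p1 s x a t (l2norm (vsub m x.2)) z1)) _ _)).
- by move=> z1; exact: Phi_ge0.
- by [].
by apply: eq_integral => z1 _; rewrite subrr mul0r sube0.
Qed.

Lemma law_closed_form m t : 0 < l2norm (vsub m x.2) -> 0 < t ->
  law p1 s (a, m) [set z | gamma p1 s x (a, m) z <= t] =
  closed_form p1 s x a t (l2norm (vsub m x.2)).
Proof.
move=> r0 t0; rewrite (law_gamma_le a m r0 t0).
apply/esym/(etrans (@esum_support a
  (fun z1 => Phi (threshold_arg p1 s x a t (l2norm (vsub m x.2)) z1 -
     (l2norm (vsub m x.2) / s)%:E)%E) _ _)).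
- by move=> z1; exact: Phi_ge0.
- exact: abs_cont.
apply: eq_integral => z1 _; rewrite -dot_vsubr -l2norm_sqr.
rewrite (_ : l2norm (vsub m x.2) ^+ 2 / (s * l2norm (vsub m x.2)) =
  l2norm (vsub m x.2) / s)//.
by field; rewrite !gt_eqF.
Qed.

(** Each slice is empty when [gamma1] is 0, because [t > 0], and otherwise lies in a hyperplane. *)
Lemma law_gamma_eq0 m t : 0 < l2norm (vsub m x.2) -> 0 < t ->
  law p1 s x [set z | gamma p1 s x (a, m) z = t] = 0%E.
Proof.
move=> r0 t0; rewrite law_slices; last first.
  by apply: measurable_eq_level; exact: measurable_gamma.
apply: integral0_eq => z1 _.
have := gamma1_ge0 z1; rewrite le_eqVlt => /orP[/eqP/esym g0|g0].
  rewrite (_ : [set z2 | _] = set0) ?measure0//.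
  apply/seteqP; split => // z2 /=; rewrite /gamma/= g0 mul0r => t0'.
  by move: t0; rewrite -t0' ltxx.
apply/eqP; rewrite -measure_le0 -(gaussian_hyperplane x.2 s0 r0 (slice_bound m z1 t)).
apply: le_measure; rewrite ?inE.
- apply: (@measurable_slice [set z | gamma p1 s x (a, m) z = t]).
  by apply: measurable_eq_level; exact: measurable_gamma.
- exact: (measurable_dot_set _ (measurable_set1 _)).
- by move=> z2 /=; exact: gamma_eq.
Qed.

Lemma law_setX_setT y (A : set X1) :
  law p1 s y [set z | A z.1] = p1 y.1 A.
Proof.
rewrite (_ : [set z | A z.1] = A `*` setT); last first.
  by apply/seteqP; split => z //= -[].
have mA := X1_discrete A.
by rewrite /law/= product_measure1E// [X in (_ * X)%E]probability_setT mule1.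
Qed.

Lemma law_gamma_le0 m :
  law p1 s x [set z | (gamma p1 s x (a, m) z <= 0)%R] = p1 x.1 [set z1 | ga z1 = 0].
Proof.
rewrite -law_setX_setT; congr (law p1 s x _); apply/seteqP; split => z /=.
  rewrite /gamma/= pmulr_lle0; last by rewrite gamma2E expR_gt0.
  by move=> g_le0; apply/eqP; rewrite eq_le g_le0 gamma1_ge0.
by rewrite /gamma/= => ->; rewrite mul0r.
Qed.

Lemma gamma1_pos_exists : (p1 x.1 [set z1 | ga z1 = 0%R] < 1)%E ->
  exists z1, 0 < mass (p1 x.1) z1 /\ 0 < ga z1.
Proof.
move=> P1; apply: contrapT => /forallNP npos.
have : p1 x.1 (~` [set z1 | ga z1 = 0]) = 0%E.
  apply: discrete_null => z1 /= g0; apply/eqP/negP => /negP m0; apply: (npos z1).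
  by split; rewrite lt_neqAle eq_sym ?gamma1_ge0 ?mass_ge0 ?andbT//; exact/eqP.
move=> PC; move: P1; rewrite -[X in p1 x.1 X]setCK.
by rewrite (probability_setC _ (X1_discrete _)) PC sube0 ltxx.
Qed.

(** Raising the level from [t] to [t'] adds at least the slab [B] over one point [z1] with positive
    clean mass and positive [gamma1], and this slab has positive probability. *)
Lemma F_increasing m t t' : 0 < l2norm (vsub m x.2) ->
  (p1 x.1 [set z1 | ga z1 = 0%R] < 1)%E -> 0 < t -> t < t' ->
  (F p1 s x a t (l2norm (vsub m x.2)) < F p1 s x a t' (l2norm (vsub m x.2)))%E.
Proof.
move=> r0 P1 t0 tt'; have t'0 := lt_trans t0 tt'.
rewrite -!law_F//; have [z1 [m0 g0]] := gamma1_pos_exists P1.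
set A := [set z | gamma p1 s x (a, m) z <= t].
set A' := [set z | gamma p1 s x (a, m) z <= t'].
pose B := [set z1] `*` [set z2 : vec R D |
  slice_bound m z1 t < dot (vsub m x.2) z2 <= slice_bound m z1 t'].
have mB2 : measurable [set z2 : vec R D |
    slice_bound m z1 t < dot (vsub m x.2) z2 <= slice_bound m z1 t'].
  rewrite (_ : [set z2 | _] = [set z2 | `]slice_bound m z1 t, slice_bound m z1 t']%classic
    (dot (vsub m x.2) z2)]).
    exact: (measurable_dot_set _ (measurable_itv _)).
  by apply/seteqP; split => z2 /=; rewrite in_itv.
have mz1 : measurable [set z1] by exact: X1_discrete.
have mB : measurable B by exact: measurableX.
have mA : measurable A by exact: measurable_gamma_le.
have mA' : measurable A' by exact: measurable_gamma_le.
have B0 : (0 < law p1 s x B)%E.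
  have pz : (0 < p1 x.1 [set z1])%E by rewrite EFin_mass lte_fin.
  rewrite /law/= product_measure1E// mule_gt0//.
  exact: (gaussian_slab_gt0 x.2 s0 r0 (slice_bound_lt m z1 t0 tt')).
have AB : A `&` B = set0.
  apply/seteqP; split => // -[u1 u2] [Au [/= u1z /andP[lt_u _]]].
  by move: Au; rewrite /A/= u1z gamma_le// leNgt lt_u.
apply: (@lt_le_trans _ _ (law p1 s x A + law p1 s x B)%E).
  by rewrite lteDl// fin_num_measure.
rewrite -measureU//; apply: le_measure; rewrite ?inE//; first exact: measurableU.
move=> [u1 u2] [|[/= u1z /andP[_ le_u]]]; rewrite /A/A'/=.
  by move=> /le_trans; apply; exact: ltW.
by rewrite u1z gamma_le.
Qed.

(** * The adversarial value and its dependence on the radius *)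

Context (pA : \bar R).

Lemma smoothed_ge0 y h : (forall z, 0 <= h z <= 1) -> (0 <= smoothed p1 s y h)%E.
Proof.
move=> h01; rewrite smoothedE; apply: integral_ge0 => z _.
by rewrite lee_fin; case/andP: (h01 z).
Qed.

Lemma adv_value_ge0 y : (0 <= adv_value p1 s x pA y)%E.
Proof. by apply/ereal_infP => _ [h [_ h01 _] <-]; exact: smoothed_ge0. Qed.

Lemma adv_value_le y h : feasible p1 s x pA h ->
  (adv_value p1 s x pA y <= smoothed p1 s y h)%E.
Proof. by move=> hf; apply: ereal_inf_lbound; exists h. Qed.

Lemma adv_value_minimizer y h : feasible p1 s x pA h ->
  (forall h', feasible p1 s x pA h' -> smoothed p1 s y h <= smoothed p1 s y h')%E ->
  adv_value p1 s x pA y = smoothed p1 s y h.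
Proof.
move=> hf hmin; apply/eqP; rewrite eq_le adv_value_le//=.
by apply/ereal_infP => _ [h' h'f <-]; exact: hmin.
Qed.

Lemma V_eq r v : (exists m, l2norm (vsub m x.2) = r) ->
  (forall m, l2norm (vsub m x.2) = r -> adv_value p1 s x pA (a, m) = v) ->
  V p1 s x pA a r = v.
Proof.
move=> [m mr] advE; rewrite -[RHS]ereal_inf1; congr ereal_inf.
apply/seteqP; split => [_ [m' m'r <-]|_ ->]; first exact: advE.
by exists m => //; exact: advE.
Qed.

Hypotheses (pA_gt0 : (0 < pA)%E) (pA_lt1 : (pA < 1)%E).

Let pA_fin : pA \is a fin_num.
Proof. by rewrite ge0_fin_numE ?ltW// (lt_trans pA_lt1)// ltry. Qed.

Lemma adv_value_degenerate m : (pA <= p1 x.1 [set z1 | ga z1 = 0%R])%E ->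
  adv_value p1 s x pA (a, m) = 0%E.
Proof.
move=> pA_le; set A1 := [set z1 | ga z1 = 0] in pA_le.
(* The constant test [c] on [A1] meets the constraint exactly, and [c <= 1] because [pA <= q]. *)
pose q := fine (p1 x.1 A1); pose c := fine pA / q.
have mA1 : measurable A1 by exact: X1_discrete.
have qE : p1 x.1 A1 = q%:E by rewrite fineK// fin_num_measure.
have pAE : pA = (fine pA)%:E by rewrite fineK.
have fpA : 0 < fine pA by rewrite -lte_fin -pAE.
have pAq : fine pA <= q by rewrite -lee_fin -pAE -qE.
have q0 : 0 < q by exact: lt_le_trans pAq.
have c0 : 0 <= c by rewrite divr_ge0// ltW.
have c1 : c <= 1 by rewrite ler_pdivrMr// mul1r.
pose A := [set z : XV | A1 z.1].
have mA : measurable A.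
  rewrite (_ : A = A1 `*` setT); first exact: measurableX.
  by apply/seteqP; split => z //= -[].
pose h (z : XV) := c * \1_A z.
have mh : measurable_fun [set: XV] h by apply: measurable_funM => //; exact: measurable_indic.
have h01 z : 0 <= h z <= 1.
  rewrite /h indicE; case: (_ \in _); rewrite ?mulr1n ?mulr0n ?mulr1 ?mulr0 ?c0 ?c1//.
  by rewrite lexx ler01.
have smh y : smoothed p1 s y h = (c%:E * p1 y.1 A1)%E.
  rewrite smoothedE; under eq_integral do rewrite EFinM.
  rewrite ge0_integralZl//; last by apply/measurable_EFinP; exact: measurable_indic.
  by congr (_ * _)%E; rewrite integral_indic// setIT; exact: law_setX_setT.
have hf : feasible p1 s x pA h.
  split => //; rewrite smh qE -EFinM /c divfK ?gt_eqF//.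
apply/eqP; rewrite eq_le adv_value_ge0 andbT.
rewrite (le_trans (adv_value_le (a, m) hf))// smh discrete_null ?mule0//= => z1 gz.
by rewrite mass_gamma1 gz mul0r.
Qed.

(** The distribution function of [gamma] under the clean law starts at the mass of [gamma1 = 0], so
    the strict inequality places [pA] above its value at level 0. *)
Lemma F_level_exists m : 0 < l2norm (vsub m x.2) ->
  (p1 x.1 [set z1 | ga z1 = 0%R] < pA)%E ->
  exists2 t, 0 < t & F p1 s x a t (l2norm (vsub m x.2)) = pA.
Proof.
move=> r0 P0.
have P0' : (law p1 s x [set z | (gamma p1 s x (a, m) z <= 0)%R] < pA)%E.
  by rewrite law_gamma_le0.
have [t t0 tE] := distribution_level_exists (measurable_gamma m)
  (fun t => @law_gamma_eq0 m t r0) P0' pA_lt1.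
by exists t => //; rewrite -law_F.
Qed.

Section threshold.
Context (m : vec R D) (t : R).
Hypotheses (r0 : 0 < l2norm (vsub m x.2)) (t0 : 0 < t)
  (Ft : F p1 s x a t (l2norm (vsub m x.2)) = pA).
Local Notation test := (\1_[set z | gamma p1 s x (a, m) z <= t] : XV -> R).

Lemma threshold_feasible : feasible p1 s x pA test.
Proof.
have mA := measurable_gamma_le m t; split.
- exact: measurable_indic.
- by move=> z; rewrite indicE; case: (_ \in _); rewrite ?lexx ?ler01.
- by rewrite smoothed_indic// law_F.
Qed.

Let t_ge0 : 0 <= t. Proof. exact: ltW. Qed.

Let feasible_eq h : feasible p1 s x pA h ->
  (\int[law p1 s x]_z (h z)%:E = \int[law p1 s x]_z (test z)%:E)%E.
Proof.
move=> [_ _ hE]; have [_ _ testE] := threshold_feasible.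
by rewrite -!smoothedE hE testE.
Qed.

Lemma threshold_minimal h : feasible p1 s x pA h ->
  (smoothed p1 s (a, m) test <= smoothed p1 s (a, m) h)%E.
Proof.
move=> hf; have [mh h01 _] := hf; rewrite !smoothedE.
exact: (neyman_pearson_le (measurable_gamma m) (gamma_ge0 m) t_ge0
  (@integral_law_gamma m) mh h01 (feasible_eq hf)).
Qed.

Lemma adv_value_threshold :
  adv_value p1 s x pA (a, m) = closed_form p1 s x a t (l2norm (vsub m x.2)).
Proof.
rewrite (adv_value_minimizer threshold_feasible threshold_minimal).
by rewrite smoothed_indic ?law_closed_form//; exact: measurable_gamma_le.
Qed.

Lemma threshold_unique_optimal : unique_optimal p1 s x pA (a, m) test.
Proof.
have minE := adv_value_minimizer threshold_feasible threshold_minimal.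
split; first by split; [exact: threshold_feasible | rewrite minE].
move=> h [hf hE]; have [mh h01 _] := hf.
apply: (neyman_pearson_ae (measurable_gamma m) (gamma_ge0 m) t_ge0
  (@integral_law_gamma m) mh h01 (law_gamma_eq0 r0 t0) (feasible_eq hf)).
by rewrite -!smoothedE hE minE.
Qed.

(** The test is kept fixed and only the mean moves: its half-space slices lose probability as the
    mean advances in the direction Delta. *)
Lemma smoothed_test_antitone m' m'' :
  dot (vsub m x.2) m'' <= dot (vsub m x.2) m' ->
  (smoothed p1 s (a, m') test <= smoothed p1 s (a, m'') test)%E.
Proof.
move=> dot_le; have mA := measurable_gamma_le m t.
rewrite !smoothed_indic// !law_slices//.
rewrite !integral_countable//; apply: le_esum => z1 _.
apply: lee_wpmul2r => //.
rewrite !(gaussian_gamma_slice _ _ r0 t0) lee_fin; apply: le_Phi.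
by apply: leeB => //; rewrite lee_fin ler_pM2r ?invr_gt0 ?mulr_gt0// lerD2r.
Qed.

End threshold.

(** In both regimes the value depends on the radius alone: it is 0, or the closed form at a [t]
    solving an equation in which only the radius enters. *)
Lemma adv_value_sphere m m' : 0 < l2norm (vsub m x.2) ->
  l2norm (vsub m' x.2) = l2norm (vsub m x.2) ->
  adv_value p1 s x pA (a, m') = adv_value p1 s x pA (a, m).
Proof.
move=> r0 m'm; have [P0|P0] := leP pA (p1 x.1 [set z1 | ga z1 = 0]).
  by rewrite !adv_value_degenerate.
have [t t0 Ft] := F_level_exists r0 P0.
have r0' : 0 < l2norm (vsub m' x.2) by rewrite m'm.
rewrite (adv_value_threshold r0 t0 Ft) (adv_value_threshold r0' t0) m'm//.
Qed.

Lemma adv_value_V m : 0 < l2norm (vsub m x.2) ->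
  V p1 s x pA a (l2norm (vsub m x.2)) = adv_value p1 s x pA (a, m).
Proof.
by move=> r0; apply: V_eq; [exists m | move=> m' /(adv_value_sphere r0)].
Qed.

Lemma adv_value_nonincreasing m m' : 0 < l2norm (vsub m x.2) ->
  l2norm (vsub m x.2) <= l2norm (vsub m' x.2) ->
  (adv_value p1 s x pA (a, m') <= adv_value p1 s x pA (a, m))%E.
Proof.
move=> r0 le_r; have [P0|P0] := leP pA (p1 x.1 [set z1 | ga z1 = 0]).
  by rewrite !adv_value_degenerate.
have [t t0 Ft] := F_level_exists r0 P0.
set w := vsub m x.2 in r0 le_r Ft *; set r' := l2norm (vsub m' x.2) in le_r.
(* The point at distance [r'] from [x.2] on the ray through [m]; it has the same value as [m'] by
   rotational symmetry. *)
pose m'' := vshift x.2 (r' / l2norm w) w.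
have r'0 : 0 < r' by exact: lt_le_trans le_r.
have m''r : l2norm (vsub m'' x.2) = r'.
  by rewrite l2norm_vsub_vshift ger0_norm ?divfK ?gt_eqF// divr_ge0// ltW.
have r''0 : 0 < l2norm (vsub m'' x.2) by rewrite m''r.
rewrite (@adv_value_sphere m'' m')//.
rewrite (adv_value_minimizer (threshold_feasible r0 t0 Ft) (threshold_minimal r0 t0 Ft)).
apply: (le_trans (adv_value_le _ (threshold_feasible r0 t0 Ft))).
apply: smoothed_test_antitone => //.
(* With r the norm of [w], the claim reduces to r^2 <= r' r. *)
rewrite -/w dot_vshift -lerBlDl -dot_vsubr -/w -l2norm_sqr.
have -> : r' / l2norm w * l2norm w ^+ 2 = r' * l2norm w by field; rewrite gt_eqF.
by rewrite expr2 ler_wpM2r// ltW.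
Qed.

(* At radius 0 the continuous coordinate carries no information on the
   adversarial law, so it can be averaged out of any test. *)
Lemma adv_value_radius0 m :
  (adv_value p1 s x pA (a, m) <= adv_value p1 s x pA (a, x.2))%E.
Proof.
apply/ereal_infP => _ [h [mh h01 hE] <-].
have mhz z1 : measurable_fun [set: vec R D] (fun z2 => (h (z1, z2))%:E).
  by apply/measurable_EFinP; exact: measurableT_comp.
have mh' : measurable_fun [set: XV] (EFin \o h) by exact/measurable_EFinP.
have h0 z : (0 <= (EFin \o h) z)%E by rewrite lee_fin; case/andP: (h01 z).
pose G z1 := (\int[gaussian s x.2]_z2 (h (z1, z2))%:E)%E.
have G0 z1 : (0 <= G z1)%E.
  by apply: integral_ge0 => z2 _; rewrite lee_fin; case/andP: (h01 (z1, z2)).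
have G1 z1 : (G z1 <= 1)%E.
  apply: (@le_trans _ _ (\int[gaussian s x.2]_z2 (cst 1 z2))%E).
    apply: ge0_le_integral => //.
    - by move=> z2 _; rewrite lee_fin; case/andP: (h01 (z1, z2)).
    - by move=> z2 _; rewrite lee_fin; case/andP: (h01 (z1, z2)).
  by rewrite integral_cst// mul1e probability_le1.
have Gfin z1 : G z1 \is a fin_num.
  by rewrite ge0_fin_numE// (le_lt_trans (G1 z1))// ltry.
pose k (z : XV) := fine (G z.1).
have mk : measurable_fun [set: XV] k.
  by apply: (@measurableT_comp _ _ _ _ _ _ (fun z1 => fine (G z1))).
have mk' : measurable_fun [set: XV] (EFin \o k) by exact/measurable_EFinP.
have k01 z : 0 <= k z <= 1 by rewrite -!lee_fin fineK// G0 G1.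
have k0 z : (0 <= (EFin \o k) z)%E by rewrite lee_fin; case/andP: (k01 z).
(* The value of [k] is the same for every continuous mean; [b = x.1] gives feasibility and [b = a]
   the comparison with [h]. *)
have smk b m' : smoothed p1 s (b, m') k = (\int[p1 b]_z1 G z1)%E.
  rewrite smoothedE (integral_law (b, m') mk' k0); apply: eq_integral => z1 _.
  rewrite /k/= fineK// integral_cst//.
  by rewrite [X in (_ * X)%E]probability_setT mule1.
have smh b : smoothed p1 s (b, x.2) h = (\int[p1 b]_z1 G z1)%E.
  by rewrite smoothedE (integral_law (b, x.2) mh' h0).
have kf : feasible p1 s x pA k.
  by split => //; rewrite -hE [in LHS](surjective_pairing x) smk
    [in RHS](surjective_pairing x) smh.
by apply: (le_trans (adv_value_le (a, m) kf)); rewrite smk smh.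
Qed.

End fixed_adversary.
End smoothing.

Theorem theoremA3 (R : realType) (d1 : measure_display)
    (X1 : measurableType d1)
    (X1_countable : countable [set: X1])
    (X1_discrete : forall A : set X1, measurable A)
    (D1 : X1 -> X1 -> R) (D1_metric : is_metric D1)
    (D : nat) (D_gt0 : (0 < D)%N) (d : nat)
    (sigma eps : R) (sigma_gt0 : 0 < sigma) (eps_gt0 : 0 < eps)
    (x : X1 * vec R D)
    (p1 : X1 -> probability X1 R)
    (f : X1 * vec R D -> bool) (f_meas : measurable_fun [set: X1 * vec R D] f)
    (pA : \bar R)
    (pA_def : pA = smoothed p1 sigma x (fun z => (f z)%:R))
    (pA_gt0 : (0 < pA)%E) (pA_lt1 : (pA < 1)%E)
    (x1adv : X1)
    (x1adv_budget : D1 x.1 x1adv <= d%:R)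
    (abs_cont : forall z1, mass (p1 x.1) z1 = 0 -> mass (p1 x1adv) z1 = 0) :
  [/\ forall x2adv z2 : vec R D,
        gamma2 sigma x x2adv z2 =
        expR ((sigma ^+ 2)^-1 *
              dot (vsub x2adv x.2) (vsub z2 (midpoint x.2 x2adv))),
      forall (r : R) (x2adv : vec R D), 0 < r -> l2norm (vsub x2adv x.2) = r ->
        adv_value p1 sigma x pA (x1adv, x2adv) = V p1 sigma x pA x1adv r,
      forall r : R, 0 < r ->
        (p1 x.1 [set z1 | gamma1 p1 x x1adv z1 = 0%R] < pA)%E ->
        exists t : R,
          [/\ 0 < t,
              F p1 sigma x x1adv t r = pA,
              forall t', 0 < t' -> F p1 sigma x x1adv t' r = pA -> t' = t,
              forall x2adv, l2norm (vsub x2adv x.2) = r ->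
                unique_optimal p1 sigma x pA (x1adv, x2adv)
                  \1_[set z | gamma p1 sigma x (x1adv, x2adv) z <= t] &
              V p1 sigma x pA x1adv r = closed_form p1 sigma x x1adv t r],
      forall r r' : R, 0 < r -> r <= r' ->
        (V p1 sigma x pA x1adv r' <= V p1 sigma x pA x1adv r)%E &
      [/\ forall x2adv, l2norm (vsub x2adv x.2) <= eps ->
            (V p1 sigma x pA x1adv eps <=
             adv_value p1 sigma x pA (x1adv, x2adv))%E,
          exists2 x2adv, l2norm (vsub x2adv x.2) = eps &
            adv_value p1 sigma x pA (x1adv, x2adv) = V p1 sigma x pA x1adv eps &
          p_adv p1 sigma x pA D1 d eps =
          ereal_inf [set V p1 sigma x pA a eps |
                     a in [set a | D1 x.1 a <= d%:R]] ] ].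
Proof.
have V_sphere m : 0 < l2norm (vsub m x.2) ->
    V p1 sigma x pA x1adv (l2norm (vsub m x.2)) =
    adv_value p1 sigma x pA (x1adv, m) by exact: adv_value_V.
split.
- by move=> x2adv z2; exact: gamma2E.
- by move=> r x2adv r0 rE; rewrite -rE V_sphere ?rE.
(* The facts about [F] are stated at radii of the form [l2norm (vsub m x.2)]; a point of the sphere
   puts [r] in this form. *)
- move=> r r0 P0; have [m mr] := sphere_nonempty x.2 D_gt0 (ltW r0).
  have mr0 : 0 < l2norm (vsub m x.2) by rewrite mr.
  have [t t0 Ft] : exists2 t, 0 < t &
      F p1 sigma x x1adv t (l2norm (vsub m x.2)) = pA by exact: F_level_exists.
  have P1 := lt_trans P0 pA_lt1.
  have F_lt u v : 0 < u -> u < v ->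
      (F p1 sigma x x1adv u r < F p1 sigma x x1adv v r)%E.
    by rewrite -mr; exact: F_increasing.
  exists t; rewrite mr in Ft; split => //.
  + move=> t' t'0 Ft'; have [lt|lt|//] := ltgtP t' t.
      by have := F_lt _ _ t'0 lt; rewrite Ft Ft' ltxx.
    by have := F_lt _ _ t0 lt; rewrite Ft Ft' ltxx.
  + by move=> m' m'r; apply: threshold_unique_optimal; rewrite ?m'r.
  + apply: V_eq; first by exists m.
    by move=> m' m'r; rewrite -[in RHS]m'r; apply: adv_value_threshold; rewrite ?m'r.
- move=> r r' r0 rr'; have r'0 := lt_le_trans r0 rr'.
  have [m mr] := sphere_nonempty x.2 D_gt0 (ltW r0).
  have [m' m'r'] := sphere_nonempty x.2 D_gt0 (ltW r'0).
  rewrite -mr -m'r' !V_sphere ?mr ?m'r'//.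
  by apply: adv_value_nonincreasing; rewrite ?mr ?m'r'.
- have [m me] := sphere_nonempty x.2 D_gt0 (ltW eps_gt0).
  split => //; last by exists m; rewrite // -me V_sphere ?me.
  move=> m' m'e; rewrite -me V_sphere ?me//.
  (* Monotonicity covers positive radii only; distance 0 forces [m' = x.2] and needs the averaging
     argument. *)
  have := l2norm_ge0 (vsub m' x.2); rewrite le_eqVlt => /orP[/eqP/esym|] m'0.
    by rewrite (l2norm_vsub_eq0 m'0); exact: adv_value_radius0.
  by apply: adv_value_nonincreasing; rewrite ?me.
Qed.
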